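(* Let $\Omega \subset \mathbb{R}^d$ be a convex body. Then the (lower) volume entropy of the Hilbert geometry on $\Omega$ satisfies $$\operatorname{Ent}(\Omega) \leq d-1.$$
   Context: A convex body in $\mathbb{R}^d$ is the closure of a non-empty bounded open convex set. The Hilbert geometry on a convex body $\Omega$ is the interior $\operatorname{int}\Omega$ with the Hilbert distance: for distinct $p,q\in\operatorname{int}\Omega$, let the line through $p,q$ meet $\partial\Omega$ at $a,b$, labelled so that $a,p,q,b$ occur in this order; then $d_\Omega(p,q) = \frac12\log\frac{|qa|\,|pb|}{|pa|\,|qb|}$, with $|xy|$ the Euclidean distance; $d_\Omega(p,p)=0$. $B_\Omega(p,R)$ is the closed ball of radius $R$ centred at $p$ for $d_\Omega$. For $p\in\operatorname{int}\Omega$ and $v\neq 0$ in $\mathbb{R}^d$, let $t^+,t^->0$ be such that $p+t^+v\in\partial\Omega$ and $p-t^-v\in\partial\Omega$, and put $F_\Omega(p,v)=\frac12\left(\frac1{t^+}+\frac1{t^-}\right)$, $F_\Omega(p,0)=0$. Let $\beta_\Omega(p)=\{v : F_\Omega(p,v)<1\}$, let $\beta_\Omega^*(p)$ be its polar dual, and let $\omega_d$ be the Lebesgue measure of the Euclidean unit ball of $\mathbb{R}^d$. The Holmes--Thompson volume $\operatorname{Vol}^{H}$ is the measure on $\operatorname{int}\Omega$ with density $p\mapsto\operatorname{Leb}[\beta_\Omega^*(p)]/\omega_d$ with respect to Lebesgue measure. Fix $p\in\operatorname{int}\Omega$; then $\operatorname{Ent}(\Omega):=\liminf_{R\to\infty}\frac{\log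 \operatorname{Vol}^{H}(B_\Omega(p,R))}{R}$. This does not depend on $p$. *)

(* Defs.v *)
From HB Require Import structures.
From mathcomp Require Import all_boot all_order all_algebra.
From mathcomp Require Import all_classical all_reals all_analysis.

Set Implicit Arguments.
Unset Strict Implicit.
Unset Printing Implicit Defensive.

Import Order.TTheory GRing.Theory Num.Theory.
Import numFieldNormedType.Exports.

Local Open Scope classical_set_scope.
Local Open Scope ring_scope.

Definition measure_row_display : measure_display -> measure_display.
Proof. exact. Qed.

(* The library has no measurable structure on row vectors; as for tuples, take
   the sigma-algebra generated by the coordinates, i.e. the product Borel
   sigma-algebra when T = R, which is the Borel sigma-algebra of 'rV[R]_n. *)
Section measurable_row.
Context {d} {T : sigmaRingType d}.
Variable n : nat.

Let coors : 'I_n -> 'rV[T]_n -> T := fun i v => v ord0 i.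

Let row_set0 : g_sigma_preimage coors set0.
Proof. exact: sigma_algebra0. Qed.

Let row_setC A : g_sigma_preimage coors A -> g_sigma_preimage coors (~` A).
Proof. exact: sigma_algebraC. Qed.

Let row_bigcup (F : _^nat) : (forall i, g_sigma_preimage coors (F i)) ->
  g_sigma_preimage coors (\bigcup_i (F i)).
Proof. exact: sigma_algebra_bigcup. Qed.

HB.instance Definition _ := @isMeasurable.Build (measure_row_display d)
  'rV[T]_n (g_sigma_preimage coors) row_set0 row_setC row_bigcup.

End measurable_row.

Lemma measurable_coord d (T : sigmaRingType d) n (i : 'I_n) :
  measurable_fun [set: 'rV[T]_n] (fun v : 'rV[T]_n => v ord0 i).
Proof.
move=> _ Y mY; rewrite setTI; apply: sub_sigma_algebra => /=.
rewrite -bigcup_seq/=; exists i => /=; first by rewrite mem_index_enum.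
by exists Y => //; rewrite setTI.
Qed.

Lemma measurable_fun_coord d1 d2 (T1 : measurableType d1)
    (T2 : measurableType d2) n (f : T1 -> 'rV[T2]_n) :
  (forall i, measurable_fun [set: T1] (fun x => f x ord0 i)) ->
  measurable_fun [set: T1] f.
Proof.
move=> mf.
have H : g_sigma_preimage (fun i (v : 'rV[T2]_n) => v ord0 i) `<=`
    [set B | measurable (f @^-1` B)].
  apply: smallest_sub.
    split=> [|A mA|F mF] /=.
    - by rewrite preimage_set0.
    - by rewrite setTD preimage_setC; exact: measurableC.
    - by rewrite preimage_bigcup; exact: bigcupT_measurable.
  rewrite -bigcup_seq => B [i _] [A mA <-] /=; rewrite setTI.
  by rewrite -[X in measurable X]setTI; exact: (mf i).
by move=> _ Y mY; rewrite setTI; exact: H.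
Qed.

Section lebesgue_cons.
Context {R : realType} (n : nat).

Definition cons_rV (x : R * 'rV[R]_n) : 'rV[R]_n.+1 :=
  row_mx (x.1%:M : 'rV[R]_1) x.2.

Lemma cons_rV0 x : cons_rV x ord0 ord0 = x.1.
Proof.
have -> : ord0 = lshift n (ord0 : 'I_1) :> 'I_(1 + n) by exact/val_inj.
by apply: etrans (row_mxEl _ _ _ _) _; rewrite mxE eqxx mulr1n.
Qed.

Lemma cons_rVS x j : cons_rV x ord0 (lift ord0 j) = x.2 ord0 j.
Proof.
have -> : lift ord0 j = rshift 1 j by exact/val_inj.
exact: row_mxEr.
Qed.

Lemma measurable_cons_rV : measurable_fun setT cons_rV.
Proof.
apply: measurable_fun_coord => i; case: (unliftP ord0 i) => [j ->|->].
  rewrite (_ : (fun _ => _) = (fun v : 'rV[R]_n => v ord0 j) \o snd).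
    exact: (measurableT_comp (measurable_coord j) measurable_snd).
  by apply/funext => x; exact: cons_rVS.
rewrite (_ : (fun _ => _) = fst); first exact: measurable_fst.
by apply/funext => x; exact: cons_rV0.
Qed.

Variable mu : {sigma_finite_measure set 'rV[R]_n -> \bar R}.

Definition lebesgue_cons : set 'rV[R]_n.+1 -> \bar R :=
  pushforward (@lebesgue_measure R \x mu)%E cons_rV.

Let lebesgue_cons0 : lebesgue_cons set0 = 0%E.
Proof. by rewrite /lebesgue_cons /pushforward preimage_set0 measure0. Qed.

Let lebesgue_cons_ge0 A : (0 <= lebesgue_cons A)%E.
Proof. by rewrite /lebesgue_cons /pushforward measure_ge0. Qed.

Let lebesgue_cons_sigma_additive : semi_sigma_additive lebesgue_cons.
Proof.
move=> F mF tF mUF; rewrite /lebesgue_cons /pushforward preimage_bigcup.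
apply: measure_semi_sigma_additive.
- by move=> k; rewrite -[X in measurable X]setTI; exact: measurable_cons_rV.
- apply/trivIsetP => /= i j _ _ ij; rewrite -preimage_setI.
  by move/trivIsetP : tF => /(_ _ _ _ _ ij) ->//; rewrite preimage_set0.
- rewrite -preimage_bigcup -[X in measurable X]setTI.
  exact: measurable_cons_rV.
Qed.

HB.instance Definition _ := isMeasure.Build _ _ _ lebesgue_cons
  lebesgue_cons0 lebesgue_cons_ge0 lebesgue_cons_sigma_additive.

Let lebesgue_cons_sigma_finite : sigma_finite setT lebesgue_cons.
Proof.
have /sigma_finiteP[F [TF ndF Foo]] := sigma_finiteT (@lebesgue_measure R).
have /sigma_finiteP[G [TG ndG Goo]] := sigma_finiteT mu.
pose uncons (v : 'rV[R]_n.+1) : measurableTypeR R * 'rV[R]_n :=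
  (v ord0 ord0, @rsubmx _ 1 1 n v).
have muncons : measurable_fun setT uncons.
  apply/measurable_fun_pairP; split.
    exact: measurable_coord.
  apply: measurable_fun_coord => i /=.
  under eq_fun do rewrite mxE.
  exact: measurable_coord.
have unconsK x : uncons (cons_rV x) = x.
  case: x => x v; rewrite /uncons /cons_rV row_mxKr; congr pair.
  exact: cons_rV0.
exists (fun k => uncons @^-1` (F k `*` G k)).
  apply/esym/seteqP; split=> // v _.
  have [i _ Fi] : (\bigcup_k F k) (uncons v).1 by rewrite -TF.
  have [j _ Gj] : (\bigcup_k G k) (uncons v).2 by rewrite -TG.
  exists (maxn i j) => //; split.
    by move: Fi; exact/subsetPset/ndF/leq_maxl.
  by move: Gj; exact/subsetPset/ndG/leq_maxr.
move=> k; have [mF Fk] := Foo k; have [mG Gk] := Goo k; split.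
  rewrite -[X in measurable X]setTI; apply: muncons => //.
  exact: measurableX.
rewrite /lebesgue_cons /pushforward -comp_preimage.
rewrite (_ : uncons \o _ = id); last exact/funext.
by rewrite preimage_id product_measure1E// lte_mul_pinfty// ge0_fin_numE.
Qed.

HB.instance Definition _ := Measure_isSigmaFinite.Build _ _ _ lebesgue_cons
  lebesgue_cons_sigma_finite.

End lebesgue_cons.

(* d-dimensional Lebesgue measure, on the Borel sets, as an iterated product;
   lebesgue_rV_box below is the usual characterisation by boxes. *)
Fixpoint lebesgue_rV {R : realType} (n : nat) :
    {sigma_finite_measure set 'rV[R]_n -> \bar R} :=
  match n with
  | 0 => [the {sigma_finite_measure set _ -> \bar R} of dirac (0 : 'rV[R]_0)]
  | n'.+1 => [the {sigma_finite_measure set _ -> \bar R} of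
               lebesgue_cons (lebesgue_rV n')]
  end.

Lemma measurable_box (R : realType) n (A : 'I_n -> set R) :
  (forall i, measurable (A i)) ->
  measurable [set v : 'rV[R]_n | forall i, A i (v ord0 i)].
Proof.
move=> mA.
rewrite (_ : [set v | _] =
    \bigcap_(i in setT) ((fun v : 'rV[R]_n => v ord0 i) @^-1` A i)).
  apply: fin_bigcap_measurable => // i _.
  by rewrite -[X in measurable X]setTI; exact: measurable_coord.
by apply/seteqP; split=> v Av i => [_|]; exact: Av.
Qed.

Lemma lebesgue_rV_box (R : realType) n (A : 'I_n -> set R) :
  (forall i, measurable (A i)) ->
  lebesgue_rV n [set v : 'rV[R]_n | forall i, A i (v ord0 i)] =
    (\prod_(i < n) @lebesgue_measure R (A i))%E.
Proof.
elim: n A => [|n IHn] A mA.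
  by rewrite big_ord0 /= diracE mem_set // => -[].
rewrite big_ord_recl -IHn; last by move=> i; exact: mA.
rewrite /= /lebesgue_cons /pushforward -product_measure1E; last 2 first.
- exact: mA.
- by apply: (@measurable_box R n (fun i => A (lift ord0 i))) => i; exact: mA.
congr product_measure1; apply/seteqP; split=> -[x v] /=.
  move=> Av; split=> [|i]; first by move: (Av ord0); rewrite cons_rV0.
  by move: (Av (lift ord0 i)); rewrite cons_rVS.
move=> [Ax Av] i; case: (unliftP ord0 i) => [j ->|->].
  by rewrite cons_rVS; exact: Av.
by rewrite cons_rV0.
Qed.

Section hilbert_geometry.
Context {R : realType} {d : nat}.
Implicit Types (Omega A : set 'rV[R]_d) (p q u v : 'rV[R]_d).

Definition convex_body Omega : Prop :=
  exists U : set 'rV[R]_d, [/\ U !=set0, bounded_set U, open U,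
    convex_set (U : set (convex_lmodType 'rV[R]_d)) & Omega = closure U].

Definition dotp u v : R := \sum_(i < d) u ord0 i * v ord0 i.

(* The library norm on row vectors is the sup norm. *)
Definition enorm v : R := Num.sqrt (dotp v v).

Definition boundary A : set 'rV[R]_d := closure A `\` interior A.

(* The t > 0 with p + t v on the boundary: for a convex body Omega, an interior
   point p and v != 0 it exists and is unique. *)
Definition exit_time Omega p v : R :=
  get [set t : R | 0 < t /\ boundary Omega (p + t *: v)].

(* The line through p and q meets the boundary at a, beyond p, and at b, beyond
   q. *)
Definition hilbert_dist Omega p q : R :=
  if p == q then 0 else
  let a := p + exit_time Omega p (p - q) *: (p - q) in
  let b := q + exit_time Omega q (q - p) *: (q - p) in
  2^-1 * ln ((enorm (q - a) * enorm (p - b)) / (enorm (p - a) * enorm (q - b))).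

Definition hilbert_ball Omega p (r : R) : set 'rV[R]_d :=
  [set q | interior Omega q /\ hilbert_dist Omega p q <= r].

Definition finsler_norm Omega p v : R :=
  if v == 0 then 0 else
  2^-1 * ((exit_time Omega p v)^-1 + (exit_time Omega p (- v))^-1).

Definition finsler_ball Omega p : set 'rV[R]_d :=
  [set v | finsler_norm Omega p v < 1].

(* The dual of 'rV[R]_d is identified with 'rV[R]_d by the dot product. *)
Definition polar A : set 'rV[R]_d :=
  [set w | forall v, A v -> dotp w v <= 1].

Definition unit_ball_volume : \bar R :=
  lebesgue_rV d [set v : 'rV[R]_d | enorm v <= 1].

Definition holmes_thompson_density Omega p : \bar R :=
  (lebesgue_rV d (polar (finsler_ball Omega p)) / unit_ball_volume)%E.

Definition holmes_thompson_volume Omega A : \bar R :=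
  (\int[lebesgue_rV d]_(p in A `&` interior Omega)
     holmes_thompson_density Omega p)%E.

(* The base point p is an argument; as in the usual definition it plays no role
   for p interior to a convex body. *)
Definition volume_entropy Omega p : \bar R :=
  limf_einf (fun r : R =>
    lne (holmes_thompson_volume Omega (hilbert_ball Omega p r)) * (r^-1)%:E)%E
    (+oo : set_system R).

End hilbert_geometry.
Arguments unit_ball_volume : clear implicits.

(* Main.v *)
Require Import Defs.
From mathcomp Require Import all_boot all_order all_algebra.
From mathcomp Require Import all_classical all_reals all_analysis.
From mathcomp Require Import perm measurable_realfun ring lra.
(* Write K for the polar body of Omega - p. The dual Finsler ball at x is
   comparable to the polar of Omega - x, a projective image of K, so that the
   density at x is comparable to the integral over y in K of
   (1 - <x - p, y>)^-(d+1); on the ball of radius r about p, 1 - <x - p, y> is at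
   least e^(-2r). Hence it suffices to bound by O(s^((d+3)/2)) the measure of the
   set of pairs (x, y) in Omega x K with <x - p, y> >= 1 - s, for dyadic s. In such
   a pair, x and y lie in shells of measure O(s) along the boundaries of Omega
   and K. The x whose cap {y in K : <x - p, y> >= 1 - s} has measure
   O(s^((d+1)/2)) are thus harmless. For the other x, the product of the volumes of
   a cap of K at x and of the cap of Omega at a central point y of it is
   O(s^(d+1)), by polarity (lemma cap_exchange); so a fixed proportion of a large
   cap of K consists of points y with a small cap in Omega, and exchanging the order
   of integration bounds the measure of the remaining pairs by the measure of the
   shell of K times O(s^((d+1)/2)).
   Summing over the dyadic s in [e^(-2r), 1] gives O(r e^((d-1)r)). *)

Set Implicit Arguments.
Unset Strict Implicit.
Unset Printing Implicit Defensive.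

Import Order.TTheory GRing.Theory Num.Theory.
Import numFieldNormedType.Exports.

Local Open Scope classical_set_scope.
Local Open Scope ring_scope.

(** * Product measures and affine maps of the line *)

Lemma product_measure_swap d1 d2 (T1 : measurableType d1) (T2 : measurableType d2)
    (R : realType) (m1 : {sigma_finite_measure set T1 -> \bar R})
    (m2 : {sigma_finite_measure set T2 -> \bar R}) (X : set (T1 * T2)) :
  measurable X -> ((m1 \x m2) X = (m1 \x^ m2) X)%E.
Proof.
apply: (product_measure_unique (m' := [the measure _ _ of (m1 \x^ m2)%E])) => A B mA mB.
by rewrite /= product_measure2E.
Qed.

Lemma measurable_preimage d1 d2 (T1 : measurableType d1) (T2 : measurableType d2)
    (f : T1 -> T2) (S : set T2) :
  measurable_fun setT f -> measurable S -> measurable (f @^-1` S).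
Proof. by move=> mf mS; rewrite -[X in measurable X]setTI; exact: mf. Qed.

Lemma measurable_affine1 (R : realType) (a c : R) :
  measurable_fun [set: R] (fun x : R => x * a + c).
Proof. by apply: measurable_funD => //; apply: measurable_funM. Qed.

(** A multiple of a pushforward is again a measure, so it suffices to compare it with Lebesgue
    measure on half-open intervals. For [a < 0] the preimage is closed at the other end, with the
    same length. *)
Lemma lebesgue_affine1 (R : realType) (a c : R) (S : set R) :
  a != 0 -> measurable S ->
  (`|a|%:E * lebesgue_measure ((fun x : R => x * a + c)%R @^-1` S))%E =
    lebesgue_measure S.
Proof.
move=> a0 mS; have mf : measurable_fun [set: measurableTypeR R]
    (fun x : R => x * a + c : measurableTypeR R) := measurable_affine1 a c.
pose nu := measure_function_pushforward__canonical__measure_function_Measure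
  (@lebesgue_measure R) mf.
pose mu := [the {measure set (measurableTypeR R) -> \bar R} of
  mscale (NngNum (normr_ge0 a)) nu].
apply/esym.
apply: (lebesgue_measure_unique (mu:=mu)) => //; clear S mS => S.
case=> -[x y] _ <- /=; rewrite /mu /= /mscale /= /pushforward.
have [a0'|a0'] := ltP 0 a.
  have -> : ((fun x : R => x * a + c) @^-1` `]x, y]) = `] (x - c) / a, (y - c) / a]%classic.
    apply/seteqP; split=> z /=; rewrite !in_itv /=;
    by rewrite ltr_pdivrMr // ler_pdivlMr // ltrBlDr lerBrDr.
  rewrite !lebesgue_measure_itv /= !lte_fin ltr_pM2r ?invr_gt0 // ltrD2r.
  case: ifP => _; last by rewrite mule0.
  by rewrite gtr0_norm // -!EFinB -EFinM -mulrBl; congr EFin; field.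
have {a0'} a0' : a < 0 by rewrite lt_neqAle a0.
have -> : ((fun x : R => x * a + c) @^-1` `]x, y]) = `[ (y - c) / a, (x - c) / a[%classic.
  apply/seteqP; split=> z /=; rewrite !in_itv /=;
    by rewrite ler_ndivrMr // ltr_ndivlMr // ltrBlDr lerBrDr // andbC.
rewrite !lebesgue_measure_itv /= !lte_fin ltr_nM2r ?invr_lt0 // ltrD2r.
case: ifP => _; last by rewrite mule0.
by rewrite ltr0_norm // -!EFinB -EFinM -mulrBl; congr EFin; field.
Qed.

(** * Change of variables under invertible affine maps *)

Section linear_change_of_variables.
Context {R : realType}.
Local Notation leb := (@lebesgue_rV R).

Lemma measurable_affine m n (M : 'M[R]_(m, n)) (c : 'rV[R]_n) :
  measurable_fun setT (fun v : 'rV[R]_m => v *m M + c).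
Proof.
apply: measurable_fun_coord => i.
under eq_fun do rewrite mxE mxE.
apply: measurable_funD => //; apply: measurable_sum => j.
by apply: measurable_funM => //; exact: measurable_coord.
Qed.

Lemma measurable_mulmx m n (M : 'M[R]_(m, n)) :
  measurable_fun setT (fun v : 'rV[R]_m => v *m M).
Proof.
by under eq_fun do rewrite -[_ *m _]addr0; exact: measurable_affine.
Qed.

Lemma measurable_addrv n (c : 'rV[R]_n) : measurable_fun setT (fun v : 'rV[R]_n => v + c).
Proof.
by under eq_fun do rewrite -[X in X + _]mulmx1; exact: measurable_affine.
Qed.

Lemma measurable_prod_map n (a e : R) (h : 'rV[R]_n -> 'rV[R]_n) :
  measurable_fun setT h ->
  measurable_fun [set: measurableTypeR R * 'rV[R]_n]
    (fun z => (z.1 * a + e : measurableTypeR R, h z.2)).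
Proof.
move=> mh; apply/measurable_fun_pairP; split => /=.
  exact: (measurableT_comp (measurable_affine1 a e) measurable_fst).
exact: (measurableT_comp mh measurable_snd).
Qed.

(** Inductive step in the dimension: both sides are measures in [X] that agree on rectangles, and
    the product measure is unique. *)
Lemma product_lebesgue_scale n (a e k : R) (h : 'rV[R]_n -> 'rV[R]_n) :
  a != 0 -> 0 <= k -> measurable_fun setT h ->
  (forall S, measurable S -> (k%:E * leb n (h @^-1` S))%E = leb n S) ->
  forall X, measurable X ->
    ((`|a| * k)%:E * (@lebesgue_measure R \x leb n)
      ((fun z => (z.1 * a + e : measurableTypeR R, h z.2)%R) @^-1` X))%E =
    (@lebesgue_measure R \x leb n)%E X.
Proof.
move=> a0 k0 mh hk X mX; have mf := measurable_prod_map a e mh.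
have ak0 : 0 <= `|a| * k by rewrite mulr_ge0.
pose nu := measure_function_pushforward__canonical__measure_function_Measure
  (@lebesgue_measure R \x leb n)%E mf.
pose mu := [the {measure set (measurableTypeR R * 'rV[R]_n) -> \bar R} of
  mscale (NngNum ak0) nu].
apply/esym.
apply: (product_measure_unique (m1 := @lebesgue_measure R) (m2 := leb n) (m' := mu)) => //.
move=> A B mA mB /=; rewrite /mscale /= /pushforward.
have -> : (fun z : measurableTypeR R * 'rV[R]_n => (z.1 * a + e, h z.2)) @^-1` (A `*` B) =
  ((fun x => x * a + e) @^-1` A) `*` (h @^-1` B) by [].
rewrite product_measure1E //; last 2 first.
- by apply: measurable_preimage => //; exact: (measurable_affine1 a e).
- exact: measurable_preimage.
by rewrite EFinM muleACA lebesgue_affine1 // hk.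
Qed.

Lemma cons_rVD n (z w : R * 'rV[R]_n) :
  cons_rV z + cons_rV w = cons_rV (z.1 + w.1, z.2 + w.2).
Proof.
apply/rowP => i; rewrite mxE; case: (unliftP ord0 i) => [j ->|->].
  by rewrite !cons_rVS mxE.
by rewrite !cons_rV0.
Qed.

Lemma cons_rV_surj n (v : 'rV[R]_n.+1) : exists z, v = cons_rV z.
Proof.
exists (v ord0 ord0, @rsubmx _ 1 1 n v); apply/rowP => i.
case: (unliftP ord0 i) => [j ->|->]; last by rewrite cons_rV0.
rewrite cons_rVS mxE; congr (v _ _); exact/val_inj.
Qed.

Lemma lebesgue_translate n (c : 'rV[R]_n) (S : set 'rV[R]_n) : measurable S ->
  leb n ((fun v => v + c) @^-1` S) = leb n S.
Proof.
elim: n c S => [|n IHn] c S mS.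
  congr (leb 0 _); apply/seteqP; split=> v /=; by rewrite (thinmx0 c) addr0.
have [[c0 c'] ->] := cons_rV_surj c.
rewrite /= /lebesgue_cons /pushforward.
rewrite -[RHS](@product_lebesgue_scale n 1 c0 1 (fun v => v + c')) ?oner_neq0 //.
- rewrite normr1 mulr1 mul1e; congr product_measure1.
  by apply/seteqP; split=> -[x u] /=; rewrite cons_rVD /= mulr1.
- exact: measurable_addrv.
- by move=> T mT; rewrite mul1e IHn.
- by apply: measurable_preimage => //; exact: measurable_cons_rV.
Qed.

(** Stated with preimages, the property involves no inverse of [M] and passes to products. *)
Definition scales_lebesgue n (M : 'M[R]_n) := forall S, measurable S ->
  (`|\det M|%:E * leb n ((fun v => v *m M) @^-1` S))%E = leb n S.

Lemma scales_lebesgueM n (M N : 'M[R]_n) :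
  scales_lebesgue M -> scales_lebesgue N -> scales_lebesgue (M *m N).
Proof.
move=> hM hN S mS; rewrite det_mulmx normrM EFinM.
rewrite (_ : (_ @^-1` S) =
    (fun v => v *m M) @^-1` ((fun v => v *m N) @^-1` S)); last first.
  by apply/seteqP; split=> v /=; rewrite mulmxA.
rewrite muleAC hM //; last by apply: measurable_preimage => //; exact: measurable_mulmx.
by rewrite muleC hN.
Qed.

Lemma cons_rV_block n (z : R * 'rV[R]_n) (a : R) (b : 'rV[R]_n) (c : 'cV[R]_n) (D : 'M[R]_n) :
  cons_rV z *m (block_mx a%:M b c D : 'M[R]_(1 + n)) =
  cons_rV (z.1 * a + (z.2 *m c) ord0 ord0, z.1 *: b + z.2 *m D).
Proof.
have E := mul_row_block (z.1%:M : 'M[R]_(1, 1)) z.2 a%:M b c D.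
rewrite /cons_rV /=; apply: (etrans E); congr row_mx.
  by rewrite -scalar_mxM raddfD /=; congr (_ + _); exact: mx11_scalar.
by rewrite mul_scalar_mx.
Qed.

Lemma scales_diag n (a : R) (N : 'M[R]_n) : a != 0 -> scales_lebesgue N ->
  scales_lebesgue (block_mx a%:M 0 0 N : 'M[R]_(1 + n)).
Proof.
move=> a0 hN S mS; rewrite det_ublock det_scalar1 normrM.
rewrite /= /lebesgue_cons /pushforward.
rewrite -[RHS](@product_lebesgue_scale n a 0 `|\det N| (fun v => v *m N)) //.
- congr mule; congr product_measure1; apply/seteqP; split=> -[x u] /=;
    by rewrite (cons_rV_block (x, u) a 0 0 N) /= mulmx0 mxE scaler0 add0r.
- exact: measurable_mulmx.
- by apply: measurable_preimage => //; exact: measurable_cons_rV.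
Qed.

(** For a fixed first coordinate [x], the shear translates the slice by [x *: b]. *)
Lemma scales_ushear n (b : 'rV[R]_n) :
  scales_lebesgue (block_mx 1%:M b 0 1%:M : 'M[R]_(1 + n)).
Proof.
move=> S mS; rewrite det_ublock !det1 mulr1 normr1 mul1e.
rewrite /= /lebesgue_cons /pushforward /product_measure1; apply: eq_integral => x _ /=.
have mT := measurable_xsection x (measurable_preimage (@measurable_cons_rV R n) mS).
rewrite -[RHS](lebesgue_translate (x *: b)) //; congr (leb n _).
apply/seteqP; split=> u; rewrite /xsection /= !inE /=;
  by rewrite (cons_rV_block (x, u) 1 b 0 1%:M) /= mulmx0 mxE addr0 mulr1 mulmx1 addrC.
Qed.

(** Here the slices are lines with [u] fixed, translated by [u *m c]; hence the exchange of the
    order of integration. *)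
Lemma scales_lshear n (c : 'cV[R]_n) :
  scales_lebesgue (block_mx 1%:M 0 c 1%:M : 'M[R]_(1 + n)).
Proof.
move=> S mS; rewrite det_lblock !det1 mulr1 normr1 mul1e.
rewrite /= /lebesgue_cons /pushforward.
have mT := measurable_preimage (@measurable_cons_rV R n) mS.
rewrite !product_measure_swap //; last first.
  apply: measurable_preimage; first exact: measurable_cons_rV.
  by apply: measurable_preimage => //; exact: measurable_mulmx.
rewrite /product_measure2; apply: eq_integral => u _ /=.
rewrite -[RHS](@lebesgue_affine1 R 1 ((u *m c) ord0 ord0)) ?oner_neq0 //; last first.
  exact: measurable_ysection.
rewrite normr1 mul1e; congr lebesgue_measure.
apply/seteqP; split=> x; rewrite /ysection /= !inE /=;
  by rewrite (cons_rV_block (x, u) 1 0 c 1%:M) /= scaler0 add0r mulmx1.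
Qed.

(* Shears and diagonal blocks generate, so the change of variables formula follows
   from Fubini and induction on the dimension. *)
Lemma block_mx_LDU n (a : R) (b : 'rV[R]_n) (c : 'cV[R]_n) (D : 'M[R]_n) :
  a != 0 -> (block_mx a%:M b c D : 'M[R]_(1 + n)) =
    block_mx 1%:M 0 (a^-1 *: c) 1%:M *m
    (block_mx a%:M 0 0 (D - a^-1 *: (c *m b)) *m block_mx 1%:M (a^-1 *: b) 0 1%:M).
Proof.
move=> a0; rewrite !mulmx_block !(mulmx0, mul0mx, mul1mx, mulmx1, addr0, add0r).
have Eb : a%:M *m (a^-1 *: b) = b by rewrite mul_scalar_mx scalerA mulfV // scale1r.
have Ec : (a^-1 *: c) *m a%:M = c by rewrite mul_mx_scalar scalerA mulfV // scale1r.
by rewrite Eb Ec -scalemxAl addrC subrK.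
Qed.

Lemma scales_unitmx n (M : 'M[R]_n) : M \in unitmx -> scales_lebesgue M.
Proof.
elim: n M => [|n IHn] M uM.
  move=> S mS; rewrite det_mx00 normr1 mul1e; congr (leb 0 _).
  by apply/seteqP; split=> v /=; rewrite (thinmx0 v) (thinmx0 (0 *m _)).
have nz_case (N : 'M[R]_(1 + n)) : N \in unitmx -> ulsubmx N 0 0 != 0 -> scales_lebesgue N.
  move=> uN a0; move: uN; rewrite -(submxK N) [ulsubmx N]mx11_scalar block_mx_LDU //.
  rewrite unitmxE !det_mulmx det_lblock !det_ublock !det1 !(mulr1, mul1r) det_scalar1.
  rewrite unitrM -(unitmxE (_ - _)) => /andP[_ uS].
  apply: scales_lebesgueM; first exact: scales_lshear.
  by apply: scales_lebesgueM; [apply: scales_diag => //; exact: IHn|exact: scales_ushear].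
have [u0|u0] := eqVneq (ulsubmx (M : 'M[R]_(1 + n)) 0 0) 0; last exact: nz_case.
pose N := M : 'M[R]_(1 + n).
have [j bj] : exists j, ursubmx N 0 j != 0.
  apply/existsP; apply: contraT; rewrite negb_exists => /forallP b0.
  have b0' : ursubmx N = 0.
    by apply/rowP => j; rewrite [RHS]mxE; apply/eqP; rewrite -[_ == _]negbK.
  have E : \det N = 0.
    by rewrite -(submxK N) b0' det_lblock [ulsubmx N]mx11_scalar u0 det_scalar1 mul0r.
  by move: uM; rewrite unitmxE -[M]/N E unitr0.
(* Adding a multiple of the column of the nonzero entry [j] to the first column turns the vanishing
   pivot into 1; [L (- e)] undoes this operation. *)
pose e : 'cV[R]_n := (ursubmx N 0 j)^-1 *: delta_mx j 0.
pose L (e : 'cV[R]_n) : 'M[R]_(1 + n) := block_mx 1%:M 0 e 1%:M.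
have LK : L e *m L (- e) = 1%:M.
  rewrite /L mulmx_block !(mulmx0, mul0mx, mul1mx, mulmx1, addr0, add0r) subrr.
  by rewrite -scalar_mx_block.
have -> : M = (N *m L e) *m L (- e) by rewrite -mulmxA LK mulmx1.
apply: scales_lebesgueM; last exact: scales_lshear.
apply: nz_case.
  by rewrite unitmx_mul uM unitmxE det_lblock !det1 mulr1 unitr1.
rewrite -(submxK N) /L mulmx_block block_mxKul mulmx1 mxE u0 add0r.
by rewrite /e -scalemxAr mxE -colE [col _ _ _ _]mxE mulVf ?oner_neq0.
Qed.

Lemma lebesgue_affine n (M : 'M[R]_n) (c : 'rV[R]_n) S : M \in unitmx -> measurable S ->
  (`|\det M|%:E * leb n ((fun v => v *m M + c)%R @^-1` S))%E = leb n S.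
Proof.
move=> uM mS; rewrite -(lebesgue_translate c mS) -[RHS](scales_unitmx uM) //.
by apply: measurable_preimage => //; exact: measurable_addrv.
Qed.
End linear_change_of_variables.

(** * Topology, scalar product and separation for row vectors *)

Section row_vectors.
Context {R : realType} {d : nat}.
Implicit Types (u v w x y z : 'rV[R]_d) (A C : set 'rV[R]_d).

Lemma nbhs_boxP x A : nbhs x A <->
  exists2 r : R, 0 < r & forall y, (forall i, `|x ord0 i - y ord0 i| < r) -> A y.
Proof.
split=> [/nbhs_ballP[r /= r0 xA]|[r r0 xA]].
  exists r => // y xy; apply: xA; split=> // i j.
  by rewrite (ord1 i) /ball /=; exact: xy.
apply/nbhs_ballP; exists r => //= y [_ xy]; apply: xA => i.
by have := xy ord0 i.
Qed.

Lemma closure_boxP x A : closure A x <->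
  forall r, 0 < r -> exists2 y, A y & forall i, `|x ord0 i - y ord0 i| < r.
Proof.
split=> [xA r r0|xA B /nbhs_boxP[r r0 rB]].
  have [y [Ay xy]] : A `&` [set y | forall i, `|x ord0 i - y ord0 i| < r] !=set0.
    by apply: xA; apply/nbhs_boxP; exists r.
  by exists y.
by have [y Ay xy] := xA _ r0; exists y; split => //; exact: rB.
Qed.

(** The sigma-algebra is generated by the coordinates, so the open set is written as a countable
    union of boxes: those with rational center and radius 1/(k+1) that it contains. *)
Lemma open_measurable_rV A : open A -> measurable A.
Proof.
move=> oA.
pose box (qk : 'rV[rat]_d * nat) : set 'rV[R]_d :=
  [set v | forall i, ball (ratr (qk.1 ord0 i) : R) (qk.2.+1%:R^-1) (v ord0 i)].
have -> : A = \bigcup_qk (if `[< box qk `<=` A >] then box qk else set0).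
  apply/seteqP; split=> [x Ax|x [qk _]]; last by case: asboolP => // + ?; apply.
  have /nbhs_boxP[r r0 rA] : nbhs x A by exact: open_nbhs_nbhs.
  have [k kr] : exists k, k.+1%:R^-1 < r / 2.
    near \oo => k; exists k; near: k.
    exact: (near_infty_natSinv_lt (PosNum (divr_gt0 r0 (ltr0n R 2)))).
  have [q qx] : exists q : 'rV[rat]_d, forall i, `|ratr (q ord0 i) - x ord0 i| < k.+1%:R^-1.
    suff /choice[f fP] : forall i, exists a : rat, `|ratr a - x ord0 i| < k.+1%:R^-1.
      by exists (\row_i f i) => i; rewrite mxE.
    move=> i; have := @rat_in_itvoo R (x ord0 i) (x ord0 i + k.+1%:R^-1).
    rewrite ltrDl invr_gt0 ltr0Sn => /(_ isT)[a]; rewrite in_itv /= => /andP[ax xa].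
    by exists a; rewrite gtr0_norm ?subr_gt0 // ltrBlDl.
  exists (q, k) => //; case: asboolP => [_|]; first by move=> i; exact: qx.
  case=> y yb; apply: rA => i; have := yb i; have := qx i; rewrite /ball /=.
  move: kr; rewrite -[x _ _ - y _ _](subrKA (ratr (q ord0 i))) => kr xq qy.
  rewrite (le_lt_trans (ler_normD _ _)) // (distrC (x _ _)) (splitr r).
  by apply: lt_le_trans (ltrD xq qy) _; rewrite lerD ?ltW.
apply: countable_bigcupT_measurable => [|qk]; first exact: countableP.
case: asboolP => // _.
apply: (@measurable_box R d (fun i => ball (ratr (qk.1 ord0 i) : R) qk.2.+1%:R^-1)) => i.
exact: measurable_ball.
Unshelve. all: by end_near. Qed.

Lemma closed_measurable_rV A : closed A -> measurable A.
Proof.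
move=> cA; rewrite -(setCK A); apply: measurableC; apply: open_measurable_rV.
by rewrite openC.
Qed.

Lemma dotpC u v : dotp u v = dotp v u.
Proof. by apply: eq_bigr => i _; rewrite mulrC. Qed.

Lemma dotpDl u v w : dotp (u + v) w = dotp u w + dotp v w.
Proof. by rewrite -big_split; apply: eq_bigr => i _; rewrite mxE mulrDl. Qed.

Lemma dotpZl (a : R) u w : dotp (a *: u) w = a * dotp u w.
Proof. by rewrite mulr_sumr; apply: eq_bigr => i _; rewrite mxE mulrA. Qed.

Lemma dotpNl u w : dotp (- u) w = - dotp u w.
Proof. by rewrite -scaleN1r dotpZl mulN1r. Qed.

Lemma dotpBl u v w : dotp (u - v) w = dotp u w - dotp v w.
Proof. by rewrite dotpDl dotpNl. Qed.

Lemma dotpDr u v w : dotp w (u + v) = dotp w u + dotp w v.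
Proof. by rewrite dotpC dotpDl !(dotpC w). Qed.

Lemma dotpZr (a : R) u w : dotp w (a *: u) = a * dotp w u.
Proof. by rewrite dotpC dotpZl (dotpC w). Qed.

Lemma dotpNr u w : dotp w (- u) = - dotp w u.
Proof. by rewrite dotpC dotpNl (dotpC w). Qed.

Lemma dotpBr u v w : dotp w (u - v) = dotp w u - dotp w v.
Proof. by rewrite dotpDr dotpNr. Qed.

Lemma dotp0l w : dotp 0 w = 0.
Proof. by rewrite -(scale0r 0) dotpZl mul0r. Qed.

Lemma dotp0r w : dotp w 0 = 0.
Proof. by rewrite dotpC dotp0l. Qed.

Lemma dotp_sqrB u v (t : R) :
  dotp (u - t *: v) (u - t *: v) = dotp u u - 2 * t * dotp u v + t ^+ 2 * dotp v v.
Proof. by rewrite dotpBl !dotpBr !dotpZl !dotpZr (dotpC v u); ring. Qed.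

Lemma dotp_suml (I : finType) (P : pred I) (a : I -> R) (F : I -> 'rV[R]_d) w :
  dotp (\sum_(i | P i) a i *: F i) w = \sum_(i | P i) a i * dotp (F i) w.
Proof.
rewrite (big_morph (fun u => dotp u w) (fun u v => dotpDl u v w) (dotp0l w)).
by apply: eq_bigr => i _; rewrite dotpZl.
Qed.

Lemma dotp_ge0 u : 0 <= dotp u u.
Proof. by apply: sumr_ge0 => i _; rewrite -expr2 sqr_ge0. Qed.

Lemma dotp_eq0 u : (dotp u u == 0) = (u == 0).
Proof.
apply/idP/eqP => [|->]; last by rewrite dotp0l.
rewrite psumr_eq0 => [/allP u0|i _]; last by rewrite -expr2 sqr_ge0.
apply/rowP => i; rewrite mxE; apply/eqP.
by have := u0 i; rewrite mem_index_enum -expr2 sqrf_eq0 => /(_ isT).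
Qed.

Lemma dotp_gt0 u : (0 < dotp u u) = (u != 0).
Proof. by rewrite lt_neqAle dotp_ge0 andbT eq_sym dotp_eq0. Qed.

Lemma dotp_delta u i : dotp u (delta_mx 0 i) = u ord0 i.
Proof.
rewrite /dotp (bigD1 i) //= mxE !eqxx mulr1 big1 ?addr0 // => j ji.
by rewrite mxE (negbTE ji) andbF mulr0.
Qed.

Lemma dotp_row_mx (M : 'M[R]_d) u i : (u *m M^T) ord0 i = dotp u (row i M).
Proof. by rewrite mxE; apply: eq_bigr => j _; rewrite !mxE. Qed.

Lemma continuous_sum_coord (F : 'I_d -> 'rV[R]_d -> R) :
  (forall i, continuous (F i)) -> continuous (fun v => \sum_i F i v).
Proof.
move=> cF; elim: (index_enum _) => [|i r IHr] x.
  rewrite (_ : (fun v => _) = cst 0); first exact: cst_continuous.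
  by apply/funext => v; rewrite big_nil.
rewrite (_ : (fun v => _) = F i \+ (fun v => \sum_(j <- r) F j v)).
  exact: (continuousD (cF i x) (IHr x)).
by apply/funext => v; rewrite big_cons.
Qed.

Lemma continuous_dotpl u : continuous (dotp u).
Proof.
apply: continuous_sum_coord => i x.
by apply: (continuousM (s := cst (u ord0 i))); [exact: cst_continuous|exact: coord_continuous].
Qed.

Lemma measurable_dotpl u : measurable_fun setT (dotp u).
Proof.
by apply: measurable_sum => i; apply: measurable_funM => //; exact: measurable_coord.
Qed.

Lemma closed_halfspaces A (c : 'rV[R]_d -> R) :
  closed [set w | forall v, A v -> dotp w v <= c v].
Proof.
rewrite (_ : [set w | _] = \bigcap_(v in A) (dotp v @^-1` [set a | a <= c v])).
  apply: closed_bigI => v _; apply: closed_comp; last exact: closed_le.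
  by move=> x _; exact: continuous_dotpl.
by apply/seteqP; split=> w wA v /wA; rewrite /= dotpC.
Qed.

Lemma closed_polar A : closed (polar A).
Proof. exact: (@closed_halfspaces A (fun=> 1)). Qed.

Definition is_convex C :=
  forall x y (t : R), C x -> C y -> 0 <= t <= 1 -> C (t *: x + (1 - t) *: y).

(** Take for [z] a point of [C] nearest to [q], and [u = q - z]. *)
Lemma nearest_point_separation C q : compact C -> is_convex C -> C !=set0 -> ~ C q ->
  exists u z, [/\ C z, 0 < dotp u (q - z) & forall w, C w -> dotp u (w - z) <= 0].
Proof.
move=> cC kC C0 nCq.
have cf : continuous (fun w => dotp (q - w) (q - w)).
  apply: continuous_sum_coord => i x.
  have cg : {for x, continuous (fun w => (q - w) ord0 i)}.
    rewrite (_ : (fun w => _) = cst (q ord0 i) - (fun w => w ord0 i)).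
      by apply: continuousB; [exact: cst_continuous|exact: coord_continuous].
    by apply/funext => w; rewrite !mxE.
  exact: (continuousM cg cg).
have [z /set_mem Cz zmin] := compact_EVT_min C0 cC (continuous_subspaceT cf).
have u0 : q - z != 0 by apply: contra_notN nCq; rewrite subr_eq0 => /eqP ->.
exists (q - z), z; split => //; first by rewrite dotp_gt0.
move=> w Cw; rewrite leNgt; apply/negP; set s := dotp _ _ => s0.
pose N := dotp (w - z) (w - z); have N0 : 0 <= N by exact: dotp_ge0.
have D0 : 0 < N + s + 1 by lra.
(* If [s > 0], a short step from [z] towards [w] comes closer to [q]: this [t] lies in []0, 1]] and
   satisfies [t * N < 2 * s]. *)
pose t := s / (N + s + 1).
have tE : t * (N + s + 1) = s by rewrite /t divfK // gt_eqF.
have t0 : 0 < t by rewrite /t divr_gt0.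
have t1 : t <= 1 by rewrite /t ler_pdivrMr //; lra.
have := zmin (t *: w + (1 - t) *: z); rewrite inE => /(_ (kC _ _ _ Cw Cz _)).
rewrite (ltW t0) t1 => /(_ isT).
have -> : q - (t *: w + (1 - t) *: z) = (q - z) - t *: (w - z).
  by apply/rowP => i; rewrite !mxE; ring.
rewrite dotp_sqrB -/s -/N.
nra.
Qed.

End row_vectors.

(** * Volumes of boxes and near-maximal determinants *)

Section determinants.
Context {R : realType} {d : nat}.
Local Notation leb := (@lebesgue_rV R).
Implicit Types (M : 'M[R]_d) (K : set 'rV[R]_d).

Lemma lebesgue_rV_itv n (a b : 'I_n -> R) : (forall i, a i <= b i) ->
  leb n [set v | forall i, a i <= v ord0 i <= b i] = (\prod_i (b i - a i))%:E.
Proof.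
move=> ab; have := @lebesgue_rV_box R n (fun i => `[a i, b i]%classic).
move=> /(_ (fun i => measurable_itv _)) E; rewrite -prodEFin.
transitivity (\prod_(i < n) lebesgue_measure `[a i, b i]%classic)%E.
  rewrite -E; congr (leb n _); apply/seteqP; split=> v /= vab i; have := vab i;
    by rewrite /= in_itv.
apply: eq_bigr => i _; rewrite lebesgue_measure_itv /= lte_fin.
case: ltgtP (ab i) => // -> _; by rewrite subrr.
Qed.

Lemma measurable_itv_rV n (a b : 'I_n -> R) :
  measurable [set v : 'rV[R]_n | forall i, a i <= v ord0 i <= b i].
Proof.
have := @measurable_box R n (fun i => `[a i, b i]%classic) (fun i => measurable_itv _).
rewrite (_ : [set v | _] = [set v : 'rV[R]_n | forall i, a i <= v ord0 i <= b i]) //.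
Qed.

(** The expansion along row [i] involves only cofactors of [M], which form a column of the
    adjugate. *)
Lemma det_subst_row M (w : 'rV[R]_d) i : M \in unitmx ->
  \det (\matrix_(k, l) if k == i then w ord0 l else M k l) =
    \det M * (w *m invmx M) ord0 i.
Proof.
move=> uM; rewrite (expand_det_row _ i) /invmx uM -scalemxAr mxE mulrA mulfV; last first.
  by rewrite -unitfE -unitmxE.
rewrite mul1r mxE; apply: eq_bigr => j _; rewrite !mxE eqxx; congr (_ * (_ * \det _)).
by apply/matrixP => k l; rewrite !mxE eq_sym (negbTE (neq_lift _ _)).
Qed.

Lemma det_le_fact M (B : R) : (forall i j, `|M i j| <= B) -> `|\det M| <= d`!%:R * B ^+ d.
Proof.
move=> MB; rewrite /determinant (le_trans (ler_norm_sum _ _ _)) //.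
rewrite -(card_Sn d) -sum1_card natr_sum mulr_suml.
apply: ler_sum => s _; rewrite mul1r normrM normrX normrN1 expr1n mul1r normr_prod.
rewrite -[X in B ^+ X]card_ord -prodr_const; apply: ler_prod => i _.
by rewrite normr_ge0 MB.
Qed.

(* Cramer's rule turns near-maximality of |det M| into bounded coordinates; an
   exact maximiser would need K to be compact. *)
Lemma near_max_det K (B : R) M0 :
  (forall k i, K k -> `|k ord0 i| <= B) -> (forall i, K (row i M0)) -> M0 \in unitmx ->
  exists M, [/\ M \in unitmx, forall i, K (row i M) &
    forall k i, K k -> `|(k *m invmx M) ord0 i| <= 2].
Proof.
move=> KB M0K uM0.
pose S := [set `|\det M| | M in [set M : 'M[R]_d | forall i, K (row i M)]].
have hS : has_sup S.
  split; first by exists `|\det M0|, M0.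
  exists (d`!%:R * B ^+ d) => _ [M MK <-]; apply: det_le_fact => i j.
  by have := KB _ j (MK i); rewrite mxE.
have S0 : 0 < sup S.
  apply: (@lt_le_trans _ _ `|\det M0|); last by apply: ub_le_sup; [case: hS|exists M0].
  by rewrite normr_gt0 -unitfE -unitmxE.
have [_ [M MK <-] Msup] := sup_adherent (divr_gt0 S0 (ltr0n R 2)) hS.
have {}Msup : sup S < 2 * `|\det M| by lra.
have dM : 0 < `|\det M| by lra.
have uM : M \in unitmx by rewrite unitmxE unitfE -normr_gt0.
exists M; split => // k i Kk.
have : `|\det M| * `|(k *m invmx M) ord0 i| <= sup S.
  rewrite -normrM -det_subst_row //; apply: ub_le_sup; first by case: hS.
  eexists; [move=> /= l|reflexivity].
  have [->|li] := eqVneq l i.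
    rewrite (_ : row _ _ = k) //; apply/rowP => j; by rewrite !mxE eqxx.
  rewrite (_ : row _ _ = row l M) //; apply/rowP => j; by rewrite !mxE (negbTE li).
move=> h; have := le_lt_trans h Msup; rewrite mulrC ltr_pM2r // => /ltW //.
Qed.

End determinants.

(** * Convex bodies, their duals and exit times *)

Section convex_bodies.
Context {R : realType} {d : nat}.
Implicit Types (Omega : set 'rV[R]_d) (p q u v w x y z : 'rV[R]_d).

Definition dual_at Omega x := polar [set w - x | w in Omega].

Lemma dual_atP Omega x k :
  dual_at Omega x k <-> forall w, Omega w -> dotp k (w - x) <= 1.
Proof.
split=> [kx w Ow|kx _ [w Ow <-]]; last exact: kx.
by apply: kx; exists w.
Qed.

Definition coord_bounded (A : set 'rV[R]_d) (B : R) :=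
  forall w i, A w -> `|w ord0 i| <= B.

Lemma coord_le_norm v i : `|v ord0 i| <= `|v|.
Proof.
have /mapP[j Hj ->] : `|v ord0 i| \in [seq `|v x.1 x.2| | x : 'I_1 * 'I_d].
  by apply/mapP; exists (ord0, i) => //=; rewrite mem_enum.
by rewrite [leRHS]/Num.norm /= mx_normrE; apply/bigmax_geP; right => /=; exists j.
Qed.

Lemma coord_bounded_bounded_set (A : set 'rV[R]_d) (B : R) :
  0 <= B -> coord_bounded A B -> bounded_set A.
Proof.
move=> B0 AB; exists B; split; first exact: num_real.
move=> M BM w Aw /=; rewrite [leLHS]/Num.norm /= mx_normrE; apply: bigmax_le.
  by rewrite ltW // (le_lt_trans B0).
by move=> [i j] _ /=; rewrite (ord1 i) ltW // (le_lt_trans _ BM) // AB.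
Qed.

Lemma convex_body_closed Omega : convex_body Omega -> closed Omega.
Proof. by move=> [U [_ _ _ _ ->]]; exact: closed_closure. Qed.

Lemma convex_body_convex Omega : convex_body Omega -> is_convex Omega.
Proof.
move=> [U [_ _ _ cU ->]] x y t /closure_boxP Ux /closure_boxP Uy /andP[t0 t1].
apply/closure_boxP => r r0; have r2 : 0 < r / 2 by rewrite divr_gt0.
have [x' Ux' xx'] := Ux _ r2; have [y' Uy' yy'] := Uy _ r2.
exists (t *: x' + (1 - t) *: y').
  by have := cU x' y' (Itv01 t0 t1); rewrite !inE => /(_ Ux' Uy').
move=> i; rewrite !mxE; have := xx' i; have := yy' i; rewrite !ltr_norml.
move=> /andP[? ?] /andP[? ?]; have t1' : 0 <= 1 - t by lra.
apply/andP; split; nra.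
Qed.

Lemma convex_body_bounded Omega : convex_body Omega ->
  exists2 B : R, 0 < B & coord_bounded Omega B.
Proof.
move=> [U [_ bU _ _ ->]]; have [M MU] : exists M, forall w, U w -> `|w| <= M.
  have [M [_ bM]] := bU; exists (M + 1) => w Uw.
  by apply: (bM (M + 1)) => //; rewrite ltrDl.
exists (`|M| + 1) => [|w i /closure_boxP]; first by rewrite ltr_wpDl.
move=> /(_ 1 ltr01)[y Uy /(_ i) wy].
rewrite -[w _ _](subrK (y ord0 i)) (le_trans (ler_normD _ _)) // addrC lerD //; last exact: ltW.
by rewrite (le_trans (coord_le_norm _ _)) // (le_trans (MU _ Uy)) // ler_norm.
Qed.

Lemma interior_boxP Omega x : interior Omega x <->
  exists2 r : R, 0 < r & forall y, (forall i, `|x ord0 i - y ord0 i| < r) -> Omega y.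
Proof. exact: nbhs_boxP. Qed.

(** The homothety of center [y] and ratio [1 - t] maps a box around [x] to a box around the given
    point, and maps [Omega] into itself by convexity. *)
Lemma interior_segment Omega x y (t : R) : is_convex Omega -> interior Omega x -> Omega y ->
  0 <= t < 1 -> interior Omega (t *: y + (1 - t) *: x).
Proof.
move=> cO /interior_boxP[r r0 rO] Oy /andP[t0 t1].
have t1' : 0 < 1 - t by rewrite subr_gt0.
apply/interior_boxP; exists ((1 - t) * r) => [|z zr]; first exact: mulr_gt0.
have -> : z = t *: y + (1 - t) *: (x + (1 - t)^-1 *: (z - (t *: y + (1 - t) *: x))).
  by rewrite scalerDr scalerA mulfV ?gt_eqF // scale1r addrA addrC subrK.
apply: cO => //; last by rewrite t0 ltW.
apply: rO => i; rewrite !mxE opprD addrA subrr add0r normrN normrM normfV (gtr0_norm t1').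
by rewrite mulrC ltr_pdivrMr // (mulrC r) distrC; have := zr i; rewrite !mxE.
Qed.

Lemma interior_move Omega x v : interior Omega x ->
  exists2 s : R, 0 < s & forall t : R, `|t| <= s -> Omega (x + t *: v).
Proof.
move=> /interior_boxP[r r0 rO]; pose N := \sum_i `|v ord0 i|.
have N0 : 0 <= N by apply: sumr_ge0 => i _.
have D0 : 0 < N + 1 by rewrite ltr_wpDl.
(* The denominator [N + 1] stays positive when [v = 0]. *)
exists (r / (N + 1)) => [|t ts]; first by rewrite divr_gt0.
apply: rO => i; rewrite !mxE opprD addrA subrr add0r normrN normrM.
have vN : `|v ord0 i| <= N by rewrite /N (bigD1 i) //= lerDl sumr_ge0.
apply: (@le_lt_trans _ _ (r / (N + 1) * N)); first exact: ler_pM.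
rewrite mulrAC ltr_pdivrMr // ltr_pM2l //; lra.
Qed.

(** Test [k] on the two points at distance [r / 2] from [x] along each coordinate axis. *)
Lemma dual_bounded Omega x : interior Omega x ->
  exists2 B : R, 0 < B & coord_bounded (dual_at Omega x) B.
Proof.
move=> /interior_boxP[r r0 rO]; exists (2 / r) => [|k i /dual_atP kx]; first by rewrite divr_gt0.
have h (e : R) : `|e| = r / 2 -> e * k ord0 i <= 1.
  move=> er; have := kx (x + e *: delta_mx 0 i).
  rewrite addrAC subrr add0r dotpZr dotp_delta; apply; apply: rO => j.
  rewrite !mxE opprD addrA subrr add0r normrN normrM er eqxx /=.
  case: (j == i) => /=; last by rewrite normr0 mulr0.
  by rewrite normr1 mulr1; lra.
have r2 : 0 < r / 2 by rewrite divr_gt0.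
have h1 := h (r / 2) (gtr0_norm r2).
have h2 := h (- (r / 2)); rewrite normrN in h2; have {}h2 := h2 (gtr0_norm r2).
by rewrite ler_norml ler_pdivlMr // -mulNr ler_pdivrMr //; apply/andP; split; nra.
Qed.

(** Coordinates of two points of [Omega] differ by at most [2 * B], so the dual contains the vectors
    [(2 * B)^-1 *: delta_mx 0 i]. They form the invertible matrix from which [near_max_det]
    starts. *)
Lemma dual_basis Omega x (B : R) : 0 < B -> coord_bounded Omega B -> Omega x ->
  exists2 M : 'M[R]_d, M \in unitmx & forall i, dual_at Omega x (row i M).
Proof.
move=> B0 OB Ox; exists ((2 * B)^-1%:M).
  by rewrite unitmxE det_scalar; apply: unitrX; rewrite unitfE invr_neq0 // mulf_neq0 // gt_eqF.
move=> i; apply/dual_atP => w Ow.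
have -> : row i ((2 * B)^-1%:M) = (2 * B)^-1 *: delta_mx 0 i :> 'rV[R]_d.
  apply/rowP => j; rewrite !mxE eqxx eq_sym; case: (j == i) => /=.
    by rewrite mulr1n mulr1.
  by rewrite mulr0n mulr0.
rewrite dotpZl dotpC dotp_delta mulrC ler_pdivrMr ?mulr_gt0 // !mxE.
have := OB w i Ow; have := OB x i Ox; rewrite !ler_norml => /andP[? ?] /andP[? ?]; lra.
Qed.

Lemma body_compact Omega (B : R) : 0 < B -> coord_bounded Omega B -> closed Omega ->
  compact Omega.
Proof.
move=> B0 OB; apply: bounded_closed_compact.
by apply: coord_bounded_bounded_set OB; exact: ltW.
Qed.

(** If [x + v] were outside, a functional [u] separating it from [Omega], divided by its maximum
    [dotp u (z - x)] on [Omega - x], would lie in the dual and exceed 1 at [v]. That maximum is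
    positive because [x] is interior. *)
Lemma bipolar Omega x v : compact Omega -> is_convex Omega -> interior Omega x ->
  (forall k, dual_at Omega x k -> dotp k v <= 1) -> Omega (x + v).
Proof.
move=> kO cO ix kv; apply: contrapT => nO.
have Ox := interior_subset ix.
have [u [z [Oz uq uw]]] := nearest_point_separation kO cO (ex_intro _ _ Ox) nO.
have u0 : 0 < dotp u u.
  by rewrite dotp_gt0; apply: contraTneq uq => ->; rewrite dotp0l ltxx.
have c0 : 0 < dotp u (z - x).
  have [s s0 Os] := interior_move u ix.
  have ss : `|s| <= s by rewrite ger0_norm // ltW.
  have := uw _ (Os s ss).
  by rewrite !dotpBr !dotpDr !dotpZr => h; have := mulr_gt0 s0 u0; lra.
have : dual_at Omega x ((dotp u (z - x))^-1 *: u).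
  apply/dual_atP => w Ow; rewrite dotpZl mulrC ler_pdivrMr // mul1r.
  by have := uw w Ow; rewrite !dotpBr; lra.
move=> /kv; rewrite dotpZl mulrC ler_pdivrMr // mul1r.
by move: uq; rewrite !dotpBr !dotpDr; lra.
Qed.

(* When no exit time exists, [get] returns 0 and so does its inverse. *)
Lemma exit_time_inv_le Omega x v (s : R) : is_convex Omega -> interior Omega x ->
  0 < s -> Omega (x + s *: v) -> (exit_time Omega x v)^-1 <= s^-1.
Proof.
move=> cO ix s0 Osv; rewrite /exit_time; set S := [set t : R | _].
have [[t St]|nS] := pselect (S !=set0); last first.
  rewrite getPN; first by rewrite invr0 invr_ge0 ltW.
  by move=> t St; apply: nS; exists t.
have [t0 [_ nI]] : S (get S) by exact: getI St.
rewrite lef_pV2 ?posrE // leNgt; apply/negP => ts; apply: nI.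
set T := get S in t0 ts *.
have -> : x + T *: v = (T / s) *: (x + s *: v) + (1 - T / s) *: x.
  by apply/rowP => i; rewrite !mxE; field; rewrite gt_eqF.
by apply: interior_segment => //; rewrite divr_ge0 ?ltW //= ltr_pdivrMr // mul1r.
Qed.

(** The supremum of the times [t] with [x + t *: v] in [Omega] is an exit time; once one exists,
    [get] returns one. *)
Lemma exit_timeP Omega x v (B : R) : closed Omega -> coord_bounded Omega B ->
  is_convex Omega -> interior Omega x -> v != 0 ->
  0 < exit_time Omega x v /\ Omega (x + exit_time Omega x v *: v).
Proof.
move=> clO OB cO ix v0.
suff [t [t0 bt]] : exists t, 0 < t /\ boundary Omega (x + t *: v).
  have [T0 [cT _]] : [set t : R | 0 < t /\ boundary Omega (x + t *: v)] (exit_time Omega x v).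
    by apply: (@getI _ _ t).
  by split => //; rewrite {1}(proj1 (closure_id _) clO).
pose S := [set t : R | 0 <= t /\ Omega (x + t *: v)].
(* A nonzero coordinate of [v] bounds the set of times. *)
have [i vi] : exists i, v ord0 i != 0.
  apply/existsP; apply: contra_neqT v0; rewrite negb_exists => /forallP v0.
  by apply/rowP => i; rewrite mxE; apply/eqP; rewrite -[_ == _]negbK.
have S0 : S 0 by split => //; rewrite scale0r addr0; exact: interior_subset.
have hS : has_sup S.
  split; first by exists 0.
  exists ((B + `|x ord0 i|) / `|v ord0 i|) => t [t0 Ot].
  rewrite ler_pdivlMr ?normr_gt0 // -(ger0_norm t0) -normrM.
  have := OB _ i Ot; rewrite !mxE => h.
  rewrite -[t * _](addrK (x ord0 i)) addrC (le_trans (ler_normD _ _)) // normrN addrC.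
  by rewrite lerD2r addrC.
have [s s0 Os] := interior_move v ix.
have T0 : 0 < sup S.
  apply: (lt_le_trans s0); apply: ub_le_sup; first by case: hS.
  by split; [exact: ltW|apply: Os; rewrite ger0_norm // ltW].
exists (sup S); split => //; split.
  apply/closure_boxP => r r0.
  pose N := \sum_i `|v ord0 i|.
  have N0 : 0 <= N by apply: sumr_ge0.
  have D0 : 0 < N + 1 by rewrite ltr_wpDl.
  have [t [t0 Ot] tS] := sup_adherent (divr_gt0 r0 D0) hS.
  exists (x + t *: v) => // j; rewrite !mxE.
  have tS' : t <= sup S by apply: ub_le_sup; [case: hS|].
  rewrite opprD addrACA subrr add0r -mulrBl normrM ger0_norm ?subr_ge0 //.
  have vN : `|v ord0 j| <= N by rewrite /N (bigD1 j) //= lerDl sumr_ge0.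
  apply: (@le_lt_trans _ _ (r / (N + 1) * N)).
    by apply: ler_pM => //; [rewrite subr_ge0|lra].
  rewrite mulrAC ltr_pdivrMr // ltr_pM2l //; lra.
move=> iT; have [e e0 Oe] := interior_move v iT.
have : S (sup S + e).
  split; first by rewrite addr_ge0 // ltW.
  by rewrite scalerDl addrA; apply: Oe; rewrite ger0_norm // ltW.
by move=> /(ub_le_sup (proj2 hS)); lra.
Qed.

End convex_bodies.

(** * Dual Finsler balls and Hilbert balls *)

Section finsler_polar.
Context {R : realType} {d : nat}.
Local Notation leb := (@lebesgue_rV R).
Implicit Types (Omega : set 'rV[R]_d) (p q u v w x y z : 'rV[R]_d).

Lemma finsler_norm_le Omega x v (s : R) : is_convex Omega -> interior Omega x -> 0 < s ->
  Omega (x + s *: v) -> Omega (x - s *: v) -> finsler_norm Omega x v <= s^-1.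
Proof.
move=> cO ix s0 O1 O2; rewrite /finsler_norm; case: eqP => _; first by rewrite invr_ge0 ltW.
have h1 := exit_time_inv_le cO ix s0 O1.
have h2 : (exit_time Omega x (- v))^-1 <= s^-1.
  by apply: exit_time_inv_le => //; rewrite scalerN.
move: h1 h2; generalize (exit_time Omega x v)^-1 (exit_time Omega x (- v))^-1 s^-1.
by move=> a b c; lra.
Qed.

Lemma polar_finsler_sub Omega x (M : 'M[R]_d) : compact Omega -> is_convex Omega ->
  interior Omega x ->
  (forall k i, dual_at Omega x k -> `|(k *m invmx M) ord0 i| <= 2) ->
  polar (finsler_ball Omega x) `<=`
    [set w | forall i, - 4 <= (w *m invmx M) ord0 i <= 4].
Proof.
move=> kO cO ix hM w wP i.
(* With the factor 1/4, dual vectors take values at most 1 on the vectors 2v and -2v, so the bipolar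
   theorem puts [x] plus either of them in [Omega]. Then [v] and [- v] have Finsler norm at most
   1/2, hence lie in the open ball. *)
pose v := 4^-1 *: (col i (invmx M))^T.
have Ev k : dotp k v = 4^-1 * (k *m invmx M) ord0 i.
  by rewrite dotpZr mxE; congr (_ * _); apply: eq_bigr => j _; rewrite !mxE.
have Ov (e : R) : `|e| = 2 -> Omega (x + e *: v).
  move=> e2; apply: bipolar => // k /(hM k i) ki.
  rewrite dotpZr Ev (le_trans (ler_norm _)) // normrM e2 normrM gtr0_norm ?invr_gt0 //; lra.
have two : `|2 : R| = 2 by rewrite gtr0_norm.
have F : finsler_norm Omega x v < 1.
  apply: (@le_lt_trans _ _ 2^-1); last by lra.
  apply: finsler_norm_le => //; first exact: Ov.
  by rewrite -scaleNr; apply: Ov; rewrite normrN.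
have F' : finsler_norm Omega x (- v) < 1.
  apply: (@le_lt_trans _ _ 2^-1); last by lra.
  apply: finsler_norm_le => //; last by rewrite scalerN opprK; exact: Ov.
  by rewrite scalerN -scaleNr; apply: Ov; rewrite normrN.
have := wP _ F; have := wP _ F'; rewrite dotpNr !Ev.
move: ((w *m _) ord0 i) => a {F F'} ? ?; apply/andP; split; lra.
Qed.

Lemma measurable_parallelotope (M : 'M[R]_d) (c : 'rV[R]_d) (a b : 'I_d -> R) :
  measurable [set w : 'rV[R]_d | forall i, a i <= (w *m M + c) ord0 i <= b i].
Proof.
exact: (measurable_preimage (measurable_affine M c) (@measurable_itv_rV R d a b)).
Qed.

Lemma lebesgue_parallelotope (M : 'M[R]_d) (c : 'rV[R]_d) (a b : 'I_d -> R) :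
  M \in unitmx -> (forall i, a i <= b i) ->
  leb d [set w | forall i, a i <= (w *m M + c)%R ord0 i <= b i] =
    (`|\det M|^-1 * \prod_i (b i - a i))%:E.
Proof.
move=> uM ab; have dM : `|\det M| != 0 by rewrite normr_eq0 -unitfE -unitmxE.
rewrite EFinM -lebesgue_rV_itv // -(lebesgue_affine c uM (@measurable_itv_rV R d a b)).
by rewrite muleA -EFinM mulVf // mul1e.
Qed.

Lemma lebesgue_polar_finsler_le Omega x (M : 'M[R]_d) : compact Omega -> is_convex Omega ->
  interior Omega x -> M \in unitmx ->
  (forall k i, dual_at Omega x k -> `|(k *m invmx M) ord0 i| <= 2) ->
  (leb d (polar (finsler_ball Omega x)) <= (8 ^+ d * `|\det M|)%:E)%E.
Proof.
move=> kO cO ix uM hM.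
have e8 : 4 - - 4 = 8 :> R by ring.
have := @lebesgue_parallelotope (invmx M) 0 (fun=> - 4) (fun=> 4).
rewrite unitmx_inv => /(_ uM) E.
rewrite det_inv normfV invrK prodr_const card_ord in E.
have -> : 8 ^+ d * `|\det M| = `|\det M| * (4 - - 4) ^+ d.
  by rewrite mulrC e8.
rewrite -E; last by move=> _; rewrite -subr_ge0 e8.
apply: le_measure; rewrite ?inE.
- by apply: closed_measurable_rV; exact: closed_polar.
- exact: measurable_parallelotope.
- by apply: subset_trans (polar_finsler_sub kO cO ix hM) _ => w /= h i; rewrite addr0.
Qed.

Lemma enormZ (a : R) v : enorm (a *: v) = `|a| * enorm v.
Proof.
by rewrite /enorm dotpZl dotpZr mulrA -expr2 sqrtrM ?sqr_ge0 // sqrtr_sqr.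
Qed.

(** The exit point b beyond [q] satisfies b - p = (1 + tb) (q - p), so that <y, b - p> <= 1 gives
    <y, q - p> <= 1 - tb / (1 + tb). The bound on the cross-ratio makes tb / (1 + tb) at least
    e^(-2r). *)
Lemma hilbert_ball_dual Omega p q (r : R) B : closed Omega -> coord_bounded Omega B ->
  is_convex Omega -> interior Omega p -> 0 <= r -> hilbert_ball Omega p r q ->
  forall y, dual_at Omega p y -> dotp y (q - p) <= 1 - expR (- (2 * r)).
Proof.
move=> clO OB cO ip r0 [iq]; rewrite /hilbert_dist; case: eqP => [<- _|/eqP pq].
  by move=> y _; rewrite subrr dotp0r subr_ge0 expR_le1 oppr_le0 mulr_ge0.
have v0 : q - p != 0 by rewrite subr_eq0 eq_sym.

have v0' : p - q != 0 by rewrite subr_eq0.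
have [ta0 _] := exit_timeP clO OB cO ip v0'.
have [tb0 Ob] := exit_timeP clO OB cO iq v0.
set ta := exit_time Omega p _ in ta0 *; set tb := exit_time Omega q _ in tb0 Ob *.
clearbody ta tb.
have e0 : 0 < enorm (q - p) by rewrite sqrtr_gt0 dotp_gt0.
have -> : q - (p + ta *: (p - q)) = (1 + ta) *: (q - p).
  by apply/rowP => i; rewrite !mxE; ring.
have -> : p - (q + tb *: (q - p)) = (- (1 + tb)) *: (q - p).
  by apply/rowP => i; rewrite !mxE; ring.
have -> : p - (p + ta *: (p - q)) = ta *: (q - p).
  by apply/rowP => i; rewrite !mxE; ring.
have -> : q - (q + tb *: (q - p)) = (- tb) *: (q - p).
  by apply/rowP => i; rewrite !mxE; ring.
rewrite !enormZ !normrN !gtr0_norm ?addr_gt0 // => h.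
have {h} : ln ((1 + ta) * (1 + tb) / (ta * tb)) <= 2 * r.
  move: h; set E := enorm _; rewrite (_ : _ / _ = (1 + ta) * (1 + tb) / (ta * tb)); first lra.
  by field; rewrite !gt_eqF.
rewrite -ler_expR lnK; last by rewrite posrE divr_gt0 // mulr_gt0 // addr_gt0.
move=> h y /dual_atP /(_ _ Ob).
have -> : q + tb *: (q - p) - p = (1 + tb) *: (q - p).
  by apply/rowP => i; rewrite !mxE; ring.
rewrite dotpZr expRN => yb.
have eD : 0 < expR (2 * r) by exact: expR_gt0.
move: h; rewrite ler_pdivrMr ?mulr_gt0 // => h.
have h2 : 1 + tb <= expR (2 * r) * tb.
  have : ta * (1 + tb) <= ta * (expR (2 * r) * tb) by nra.
  by rewrite ler_pM2l.
have h3 : (expR (2 * r))^-1 * (1 + tb) <= tb by rewrite mulrC ler_pdivrMr // mulrC.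
rewrite -(ler_pM2l (_ : 0 < 1 + tb)) ?addr_gt0 //; lra.
Qed.

End finsler_polar.

(** * Caps of a body and of its dual *)

Section caps.
Context {R : realType} {d : nat}.
Local Notation leb := (@lebesgue_rV R).
Implicit Types (Omega : set 'rV[R]_d) (p q u v w x y z : 'rV[R]_d).

Definition cap Omega p (s : R) y := [set x | Omega x /\ 1 - s <= dotp y (x - p)].

Lemma measurable_dotp_sub y p : measurable_fun setT (fun x => dotp y (x - p)).
Proof.
under eq_fun do rewrite dotpBr.
by apply: measurable_funB; [exact: measurable_dotpl|exact: measurable_cst].
Qed.

Lemma measurable_cap Omega p s y : measurable Omega -> measurable (cap Omega p s y).
Proof.
move=> mO; apply: measurableI => //.
have := measurable_preimage (measurable_dotp_sub y p) (measurable_itv `[1 - s, +oo[).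
by rewrite (_ : _ @^-1` _ = [set x | 1 - s <= dotp y (x - p)]) //;
  apply/seteqP; split=> w /=; rewrite in_itv /= andbT.
Qed.

(** Multiplying [Y] on the left by this matrix of determinant 1 gives the rows y_i - y_i0 for i !=
    i0, together with y_i0. In this basis, the coordinate [i0] of a vector is the sum of its
    coefficients in the rows of [Y]. *)
Definition subtract_row (i0 : 'I_d) : 'M[R]_d :=
  \matrix_(i, j) ((i == j)%:R - ((i != i0) && (j == i0))%:R).

Lemma det_subtract_row i0 : \det (subtract_row i0) = 1.
Proof.
rewrite (expand_det_row _ i0) (bigD1 i0) //= big1 => [|j ji0].
  rewrite !mxE eqxx /= subr0 mul1r addr0 /cofactor exprD -expr2 sqrr_sign mul1r.
  have L k : (lift i0 k == i0) = false by rewrite eq_sym (negbTE (neq_lift _ _)).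
  rewrite (_ : row' _ _ = 1%:M) ?det1 //; apply/matrixP => i j.
  by rewrite !mxE (inj_eq lift_inj) !L andbF subr0.
by rewrite !mxE eqxx /= eq_sym (negbTE ji0) subrr mul0r.
Qed.

Lemma mul_subtract_row i0 (b : 'rV[R]_d) (Y : 'M[R]_d) :
  b *m (subtract_row i0 *m Y) =
  \sum_i (if i == i0 then b ord0 i0 - \sum_(j | j != i0) b ord0 j else b ord0 i) *: row i Y.
Proof.
rewrite mulmxA mulmx_sum_row; apply: eq_bigr => i _; congr (_ *: _).
rewrite mxE; case: eqVneq => [->|ii0].
  rewrite (bigD1 i0) //= !mxE eqxx /= subr0 mulr1 -sumrN; congr (_ + _).
  by apply: eq_bigr => j ji0; rewrite !mxE ji0 (negbTE ji0) eqxx sub0r mulrN1.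
rewrite (bigD1 i) //= !mxE eqxx (negbTE ii0) andbF subr0 mulr1 big1 ?addr0 // => j ji.
by rewrite !mxE (negbTE ji) (negbTE ii0) andbF subr0 mulr0.
Qed.

(* H consists of the sums of b_i y_i over the rows y_i of Y, with b_i between
   c e / e_i and 2 c e / e_i for i != i0, and b_i0 fixed by a total weight in
   [1 - c e, 1]; here c = 1 / (4 d), e_i = 1 - <y_i, x - p> and e = e_i0 is the least
   e_i. As all b_i are at least c e / e_i, a point w of Omega with 1 - <y, w - p> of
   order e satisfies 1 - <y_i, w - p> = O(e_i) for every i. *)
Lemma cap_exchange Omega p x (Y : 'M[R]_d) (i0 : 'I_d) (s : R) :
  measurable Omega -> Y \in unitmx -> (forall i, dual_at Omega p (row i Y)) ->
  (forall i, dotp (row i Y) (x - p) <= dotp (row i0 Y) (x - p)) ->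
  dotp (row i0 Y) (x - p) < 1 -> 3 / 4 <= dotp (row i0 Y) (x - p) ->
  1 - s <= dotp (row i0 Y) (x - p) -> s <= 4 * (1 - dotp (row i0 Y) (x - p)) ->
  let D := \prod_i (1 - dotp (row i Y) (x - p)) in
  exists2 H : set 'rV[R]_d, measurable H /\
    leb d H = ((4 * d%:R) ^- d * (1 - dotp (row i0 Y) (x - p)) ^+ d.+1 *
               (`|\det Y| / D))%:E &
    H `<=` [set y | [/\ dual_at Omega p y, 1 - 3 * s <= dotp y (x - p) &
      (leb d (cap Omega p (3 * s) y) <= ((48 * d%:R) ^+ d * (D / `|\det Y|))%:E)%E]].
Proof.
move=> mO uY YK Ymax.
pose e i : R := 1 - dotp (row i Y) (x - p).
set de : R := 1 - dotp (row i0 Y) (x - p) => lt1 ge34 ge1s les D.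
have de0 : 0 < de by rewrite subr_gt0.
have de4 : de <= 1 / 4 by rewrite /de; lra.
have des : de <= s by rewrite /de; lra.
have e_de i : de <= e i by rewrite lerD2l lerN2.
have e0 i : 0 < e i by exact: lt_le_trans (e_de i).
have dpos : 0 < d%:R :> R by rewrite ltr0n (leq_ltn_trans _ (ltn_ord i0)).
have d1 : 1 <= d%:R :> R by rewrite ler1n -(ltr0n R).
pose c : R := (4 * d%:R)^-1.
have c0 : 0 < c by rewrite invr_gt0 mulr_gt0.
have cd : c * d%:R = 1 / 4 by rewrite /c; field; rewrite gt_eqF.
have c4 : c <= 1 / 4 by nra.
pose Y' := subtract_row i0 *m Y.
have uY' : Y' \in unitmx.
  by rewrite unitmx_mul uY andbT unitmxE det_subtract_row unitr1.
pose a i := if i == i0 then 1 - c * de else c * de / e i.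
pose b i := if i == i0 then 1 else 2 * (c * de / e i).
have cde0 : 0 < c * de by exact: mulr_gt0.
have r0 i : 0 < c * de / e i by rewrite divr_gt0.
have rc i : c * de / e i <= c by rewrite ler_pdivrMr // ler_pM2l.
have ab i : a i <= b i.
  by rewrite /a /b; case: eqP => _; [lra|have := r0 i; lra].
pose H := [set y : 'rV[R]_d | forall i, a i <= (y *m invmx Y' + 0) ord0 i <= b i].
have dY0 : 0 < `|\det Y| by rewrite normr_gt0 -unitfE -unitmxE.
have D0 : 0 < D by apply: prodr_gt0 => i _; exact: e0.
exists H.
  split; first exact: measurable_parallelotope.
  rewrite lebesgue_parallelotope ?unitmx_inv // det_inv normfV invrK; congr EFin.
  rewrite det_mulmx det_subtract_row mul1r.
  (* As [e i0 = de], the side [i0] of the box, of length [c * de], is [de] times the general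
     expression; hence the exponent [d.+1]. *)
  have -> : \prod_i (b i - a i) = de * \prod_i (c * de / e i).
    rewrite (bigD1 i0) //= [in RHS](bigD1 i0) //= mulrA; congr (_ * _).
      by rewrite /a /b eqxx /e -/de; field; rewrite gt_eqF.
    by apply: eq_bigr => i ii0; rewrite /a /b (negbTE ii0); lra.
  rewrite prodf_div prodr_const card_ord -/D exprMn exprVn exprS; field.
  by rewrite !gt_eqF // exprn_gt0 // mulr_gt0.
move=> y yH.
pose be := y *m invmx Y'.
have beH i : a i <= be ord0 i <= b i by have := yH i; rewrite addr0.
pose f i := if i == i0 then be ord0 i0 - \sum_(j | j != i0) be ord0 j else be ord0 i.
have yE : y = \sum_i f i *: row i Y.
  by rewrite -mul_subtract_row -/Y' mulmxKV.
have sumf : \sum_i f i = be ord0 i0.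
  have -> : \sum_i f i = f i0 + \sum_(j | j != i0) be ord0 j.
    rewrite (bigD1 i0) //=; congr (_ + _); apply: eq_bigr => i ii0.
    by rewrite /f (negbTE ii0).
  by rewrite /f eqxx subrK.
(* The coefficients other than that of [i0] take up at most 2 c d = 1/2, so [f i0] is at least [c]
   and the lower bound [f_lo] also holds for [i0]. *)
have sum_le : \sum_(j | j != i0) (2 * c) <= 1 / 2.
  have : \sum_(j | j != i0) (2 * c) <= \sum_(j : 'I_d) (2 * c).
    by rewrite [leRHS](bigID (fun j => j != i0)) /= lerDl sumr_ge0 // => j _; lra.
  by move=> h; apply: (le_trans h); rewrite sumr_const card_ord -[_ *+ d]mulr_natr -mulrA cd; lra.
have sumbe : \sum_(j | j != i0) be ord0 j <= 1 / 2.
  apply: le_trans sum_le; apply: ler_sum => j ji0; have := beH j.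
  by rewrite /a /b (negbTE ji0) => /andP[_ h]; have := rc j; lra.
have bei0 : 1 - c * de <= be ord0 i0 <= 1 by have := beH i0; rewrite /a /b eqxx.
have f_lo i : c * de / e i <= f i.
  rewrite /f; case: eqVneq => [->|ii0]; last by have := beH i; rewrite /a (negbTE ii0) => /andP[].
  rewrite mulfK ?gt_eqF //; have /andP[h _] := bei0; nra.
have f0 i : 0 <= f i by apply: le_trans (f_lo i); exact: ltW.
have dotyE w : dotp y w = \sum_i f i * dotp (row i Y) w by rewrite yE dotp_suml.
split.
- apply/dual_atP => w Ow; rewrite dotyE.
  apply: (@le_trans _ _ (\sum_i f i)); last by rewrite sumf; case/andP: bei0.
  apply: ler_sum => i _; have h : dotp (row i Y) (w - p) <= 1 by move/dual_atP : (YK i); exact.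
  by rewrite -[leRHS]mulr1 ler_wpM2l.
(* The deficit 1 - <y, x - p> is at most [c * de] from the total weight, plus [de] from the row
   [i0], plus [de / 2] from the others: less than 3 de <= 3 s. *)
- have -> : dotp y (x - p) = be ord0 i0 - \sum_i f i * e i.
    rewrite dotyE -sumf -sumrB; apply: eq_bigr => i _; rewrite /e; ring.
  have : \sum_i f i * e i <= de + \sum_(i | i != i0) (2 * c * de).
    rewrite (bigD1 i0) //=; apply: lerD.
      rewrite {1}/f eqxx -/de -[leRHS]mul1r ler_pM2r //.
      have : 0 <= \sum_(j | j != i0) be ord0 j.
        apply: sumr_ge0 => j ji0; have := f0 j; by rewrite /f (negbTE ji0).
      by have /andP[_ ?] := bei0; lra.
    apply: ler_sum => i ii0; rewrite /f (negbTE ii0) -ler_pdivlMr //.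
    by have := beH i; rewrite /b (negbTE ii0) => /andP[_]; rewrite !mulrA.
  rewrite -mulr_suml => h; have /andP[h2 _] := bei0.
  have : (\sum_(i | i != i0) (2 * c)) * de <= 1 / 2 * de by rewrite ler_pM2r.
  nra.
(* On the cap, the nonnegative terms f_j (1 - <y_j, w - p>) add up to at most 3 s <= 12 de. With
   [f_lo], this bounds 1 - <y_i, w - p> by 12 e_i / c = 48 d e_i. *)
- pose C0 := [set w : 'rV[R]_d |
    forall i, 1 - 48 * d%:R * e i <= (w *m Y^T + - (p *m Y^T)) ord0 i <= 1].
  apply: (@le_trans _ _ (leb d C0)).
    apply: le_measure; rewrite ?inE; [exact: measurable_cap|exact: measurable_parallelotope|].
    move=> w [Ow wy] i; rewrite -mulmxBl dotp_row_mx dotpC.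
    have hw j : 0 <= 1 - dotp (row j Y) (w - p).
      by rewrite subr_ge0; move/dual_atP : (YK j); exact.
    apply/andP; split; last by rewrite -subr_ge0.
    have : f i * (1 - dotp (row i Y) (w - p)) <= 12 * de.
      apply: (@le_trans _ _ (\sum_j f j * (1 - dotp (row j Y) (w - p)))).
        by rewrite (bigD1 i) //= lerDl sumr_ge0 // => j _; rewrite mulr_ge0.
      rewrite (eq_bigr (fun j => f j - f j * dotp (row j Y) (w - p))) => [|j _]; last ring.
      rewrite sumrB -dotyE sumf; have /andP[_ ?] := bei0; lra.
    move=> h; have : c * de / e i * (1 - dotp (row i Y) (w - p)) <= 12 * de.
      by apply: le_trans h; rewrite ler_wpM2r.
    rewrite mulrAC ler_pdivrMr // => h2.
    have : c * (1 - dotp (row i Y) (w - p)) <= 12 * e i.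
      rewrite -(ler_pM2l de0); nra.
    move=> h3; have : d%:R * (c * (1 - dotp (row i Y) (w - p))) <= d%:R * (12 * e i).
      by rewrite ler_pM2l.
    rewrite mulrA (mulrC _ c) cd; nra.
  rewrite lebesgue_parallelotope ?unitmx_tr //; last by move=> i; have := e0 i; nra.
  rewrite det_tr lee_fin (eq_bigr (fun i => 48 * d%:R * e i)) => [|i _]; last by ring.
  by rewrite big_split /= prodr_const card_ord -/D mulrCA [_^-1 * _]mulrC.
Qed.

End caps.

(** * Pointwise bound for the density *)

Section pointwise.
Context {R : realType} {d : nat}.
Local Notation leb := (@lebesgue_rV R).
Implicit Types (Omega : set 'rV[R]_d) (p q u v w x y z : 'rV[R]_d).

(* The part of A outside its image by the homothety of center c and ratio t. *)
Definition shell (A : set 'rV[R]_d) (c : 'rV[R]_d) (t : R) :=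
  A `\` (fun v => t^-1 *: (v - c) + c) @^-1` A.

(** The condition on the cap bounds every section at fixed [z.2] by [T]; large caps of the dual are
    detected by the sections at fixed [z.1]. *)
Definition exchange_set Omega p (s T : R) : set ('rV[R]_d * 'rV[R]_d) :=
  [set z | [/\ Omega z.1, dual_at Omega p z.2, 1 - s <= dotp z.2 (z.1 - p) &
    (leb d (cap Omega p s z.2) <= T%:E)%E]].

Lemma measurable_dotp2 p :
  measurable_fun setT (fun z : 'rV[R]_d * 'rV[R]_d => dotp z.2 (z.1 - p)).
Proof.
apply: measurable_sum => i; apply: measurable_funM.
  exact: (measurableT_comp (measurable_coord i) measurable_snd).
under eq_fun do rewrite mxE.
apply: measurable_funD => //.
exact: (measurableT_comp (measurable_coord i) measurable_fst).
Qed.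

Lemma measurable_lebesgue_cap Omega p s : measurable Omega ->
  measurable_fun setT (fun y => leb d (cap Omega p s y)).
Proof.
move=> mO.
pose E := [set z : 'rV[R]_d * 'rV[R]_d | Omega z.1] `&`
  ((fun z : 'rV[R]_d * 'rV[R]_d => dotp z.2 (z.1 - p)) @^-1` `[1 - s, +oo[%classic).
have mE : measurable E.
  apply: measurableI; first exact: (measurable_preimage measurable_fst mO).
  by apply: measurable_preimage; [exact: measurable_dotp2|exact: measurable_itv].
have := measurable_fun_ysection (leb d) mE.
rewrite (_ : _ \o _ = (fun y => leb d (cap Omega p s y))) //.
apply/funext => y /=; congr (leb d _); apply/seteqP; split=> x;
  by rewrite /ysection /E /cap /= inE /= in_itv /= andbT.
Qed.

Lemma measurable_exchange_set Omega p s T : measurable Omega ->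
  measurable (exchange_set Omega p s T).
Proof.
move=> mO.
have -> : exchange_set Omega p s T = (fst @^-1` Omega `&` snd @^-1` dual_at Omega p) `&`
  (((fun z : 'rV[R]_d * 'rV[R]_d => dotp z.2 (z.1 - p)) @^-1` `[1 - s, +oo[%classic) `&`
  (snd @^-1` ((fun y => leb d (cap Omega p s y)) @^-1` `]-oo, T%:E]%classic))).
  apply/seteqP; split=> z; rewrite /exchange_set /= !in_itv /= andbT.
    by case.
  by move=> [[? ?] [? ?]].
apply: measurableI; apply: measurableI.
- exact: (measurable_preimage measurable_fst mO).
- apply: (measurable_preimage measurable_snd); apply: closed_measurable_rV.
  exact: closed_polar.
- by apply: measurable_preimage; [exact: measurable_dotp2|exact: measurable_itv].
- apply: (measurable_preimage measurable_snd); apply: measurable_preimage.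
    exact: measurable_lebesgue_cap.
  exact: emeasurable_itv.
Qed.

(** Change of base point: [k] goes to k / (1 + <k, x - p>), a projective map from the dual at [x] to
    the dual at [p]. The denominator is positive because [p] is interior, so that <k, p - x> < 1. *)
Lemma dual_shift Omega p x k : interior Omega p -> dual_at Omega x k ->
  let t := 1 + dotp k (x - p) in
  [/\ 0 < t, dual_at Omega p (t^-1 *: k) & 1 - dotp (t^-1 *: k) (x - p) = t^-1].
Proof.
move=> ip /dual_atP kx t.
have t0 : 0 < t.
  have [s s0 Os] := interior_move k ip.
  have ss : `|s| <= s by rewrite ger0_norm // ltW.
  have := kx _ (Os s ss); rewrite addrAC dotpDr dotpZr.
  have -> : dotp k (p - x) = - dotp k (x - p) by rewrite -dotpNr opprB.
  rewrite /t; have [->|k0] := eqVneq k 0; first by rewrite !dotp0l; lra.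
  by have := mulr_gt0 s0 (_ : 0 < dotp k k); rewrite dotp_gt0 => /(_ k0); lra.
split => //.
  apply/dual_atP => w Ow; rewrite dotpZl mulrC ler_pdivrMr // mul1r /t.
  by have := kx w Ow; rewrite !dotpBr; lra.
by rewrite dotpZl /t; field; rewrite gt_eqF.
Qed.

(** A functional at most 1 on [A - c] is at most [t] on the image of [A - c] under the homothety of
    ratio [t]. *)
Lemma shellP (A : set 'rV[R]_d) c t v u : 0 < t ->
  (forall w, A w -> dotp u (w - c) <= 1) -> t < dotp u (v - c) -> A v -> shell A c t v.
Proof.
move=> t0 uA tv Av; split => //= Aw; have := uA _ Aw.
by rewrite addrK dotpZr mulrC ler_pdivrMr // mul1r leNgt tv.
Qed.

(** Let m be least with 4^-m < de, and j = m - 3. The hypothesis [de <= 1 / 16] forces m >= 3, and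
    [4 ^- n <= de] forces m <= n + 1. *)
Lemma dyadic_scale (n : nat) (de : R) : 4 ^- n <= de -> de <= 1 / 16 ->
  exists2 j : 'I_n, de <= (2 ^+ j.+2) ^- 2 & (2 ^+ j.+2) ^- 2 <= 4 * de.
Proof.
move=> den de16.
have E m : (2 ^+ m) ^- 2 = 4 ^- m :> R.
  by rewrite -exprM mulnC exprM; congr (_ ^- _); ring.
have P0 : exists m, 4 ^- m < de.
  exists n.+1; apply: lt_le_trans den; rewrite ltf_pV2 ?posrE ?exprn_gt0 //.
  by rewrite ltr_eXn2l // ltr1n.
case: (ex_minnP P0) => m mde mmin.
have m3 : (2 < m)%N.
  rewrite ltnNge; apply/negP => m2; have := lt_le_trans mde de16.
  rewrite ltNge => /negP; apply; rewrite (_ : 1 / 16 = 4 ^- 2); last by field.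
  by rewrite lef_pV2 ?posrE ?exprn_gt0 // ler_eXn2l // ltr1n.
have le1 : de <= 4 ^- m.-1.
  rewrite leNgt; apply/negP => /mmin; rewrite -ltnS prednK ?ltnn //.
  exact: leq_trans m3.
have mn : (m <= n.+1)%N.
  apply: mmin; apply: lt_le_trans den; rewrite ltf_pV2 ?posrE ?exprn_gt0 //.
  by rewrite ltr_eXn2l // ltr1n.
case: m m3 mde le1 mn {mmin} => [|[|[|m]]] //= _ mde le1 mn.
have jn : (m < n)%N by rewrite -ltnS; exact: ltnW.
exists (Ordinal jn); rewrite E //=.
by move: mde; rewrite [4 ^+ m.+3]exprS invfM => h; lra.
Qed.

(* The scale of x is s = 4^-(j+2), which is 1 - <y, x - p> up to a factor 4, for
   the row y of Y closest to the boundary. For M near-maximal in the dual at x, the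
   first term bounds the measure when |det M| is at most s^(-(d+1)/2), the second
   one otherwise. *)
Lemma density_pointwise Omega p (B : R) : (0 < d)%N -> closed Omega -> is_convex Omega ->
  0 < B -> coord_bounded Omega B -> interior Omega p ->
  exists2 C : R, 0 < C & forall n x, interior Omega x ->
    (forall y, dual_at Omega p y -> dotp y (x - p) <= 1 - 4 ^- n) ->
    (leb d (polar (finsler_ball Omega x)) <= C%:E * (1 + \sum_(j < n)
      ((2 ^+ j.+2 ^+ d.+1)%:E * (\1_(shell Omega p (1 - 4 * (2 ^+ j.+2) ^- 2)) x)%:E +
       (2 ^+ j.+2 ^+ (2 * d.+1))%:E * leb d (xsection (exchange_set Omega p
         (3 * (2 ^+ j.+2) ^- 2) ((48 * d%:R) ^+ d * (2 ^+ j.+2) ^- d.+1)) x))))%E.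
Proof.
move=> d0 clO cO B0 OB ip.
have kO := body_compact B0 OB clO.
have mO := closed_measurable_rV clO.
have [B1 B10 B1K] := dual_bounded ip.
have dpos : 0 < d%:R :> R by rewrite ltr0n.
(* [CA] serves for [de > 1 / 16]; otherwise the summand [8 ^+ d] of [C] serves for [|det M|] at most
   [N ^+ d.+1], and [CB] for larger determinants. *)
pose CA : R := 8 ^+ d * (d`!%:R * (16 * B1) ^+ d).
pose CB : R := 8 ^+ d * ((4 * d%:R) ^+ d * 4 ^+ d.+1).
have CA0 : 0 <= CA by rewrite !mulr_ge0 // ?exprn_ge0 // mulr_ge0 // ltW.
have CB0 : 0 <= CB by rewrite !mulr_ge0 // ?exprn_ge0 // mulr_ge0 // ltW.
have e80 : 0 < 8 ^+ d :> R by rewrite exprn_gt0.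
pose C := CA + 8 ^+ d + CB.
have C0 : 0 < C by rewrite /C; lra.
exists C => // n x ix xn.
have Ox := interior_subset ix.
have [Bx Bx0 BxK] := dual_bounded ix.
have [M0 uM0 M0K] := dual_basis B0 OB Ox.
have [M [uM MK M2]] := near_max_det BxK M0K uM0.
apply: (le_trans (lebesgue_polar_finsler_le kO cO ix uM (fun k i kK => M2 k i kK))).
set Sum := (\sum_(j < n) _)%E.
have term0 (j : 'I_n) : (0 <= (2 ^+ j.+2 ^+ d.+1)%:E *
         (\1_(shell Omega p (1 - 4 * (2 ^+ j.+2) ^- 2)) x)%:E +
       (2 ^+ j.+2 ^+ (2 * d.+1))%:E * leb d (xsection (exchange_set Omega p
         (3 * (2 ^+ j.+2) ^- 2) ((48 * d%:R) ^+ d * (2 ^+ j.+2) ^- d.+1)) x))%E.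
  by rewrite adde_ge0 // mule_ge0 // lee_fin // !exprn_ge0.
have Sum0 : (0 <= Sum)%E by apply: sume_ge0.
pose t i := 1 + dotp (row i M) (x - p).
have tP i := dual_shift ip (MK i).
(* The rows of [Y] are the images of those of [M] under the projective map of [dual_shift]. The
   factors [(t i)^-1] are also the deficits 1 - <y_i, x - p>, so they cancel in the quotients [E1]
   and [E2]. *)
pose Y := diag_mx (\row_i (t i)^-1) *m M.
have rowY i : row i Y = (t i)^-1 *: row i M.
  by apply/rowP => j; rewrite /Y mul_diag_mx !mxE.
pose i00 : 'I_d := Ordinal d0.
pose i0 := [arg max_(i > i00) dotp (row i Y) (x - p)]%O.
have Ymax i : dotp (row i Y) (x - p) <= dotp (row i0 Y) (x - p).
  by rewrite /i0; case: arg_maxP => // k _; apply.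
have YK i : dual_at Omega p (row i Y) by rewrite rowY; case: (tP i).
have tE i : 1 - dotp (row i Y) (x - p) = (t i)^-1 by rewrite rowY; case: (tP i).
have t0 i : 0 < t i by case: (tP i).
have detY : \det Y = (\prod_i (t i)^-1) * \det M.
  by rewrite det_mulmx det_diag; congr (_ * _); apply: eq_bigr => i _; rewrite mxE.
have pt0 : 0 < \prod_i (t i)^-1 by apply: prodr_gt0 => i _; rewrite invr_gt0.
have dM0 : 0 < `|\det M| by rewrite normr_gt0 -unitfE -unitmxE.
have uY : Y \in unitmx.
  by rewrite unitmxE unitfE detY -normr_gt0 normrM mulr_gt0 // normr_gt0 gt_eqF.
have E1 : (\prod_i (1 - dotp (row i Y) (x - p))) / `|\det Y| = `|\det M|^-1.
  rewrite (eq_bigr _ (fun i _ => tE i)) detY normrM gtr0_norm //; field.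
  by rewrite !gt_eqF.
have E2 : `|\det Y| / (\prod_i (1 - dotp (row i Y) (x - p))) = `|\det M|.
  by rewrite -[LHS]invrK invf_div E1 invrK.
pose de : R := 1 - dotp (row i0 Y) (x - p).
have de0 : 0 < de by rewrite /de tE invr_gt0.
have den : 4 ^- n <= de by have := xn _ (YK i0); rewrite /de; lra.
have [de16|de16] := lerP de (1 / 16); last first.
  (* Here every [t i] is less than 16, so the entries of [M] are at most [16 * B1]. *)
  have h : `|\det M| <= d`!%:R * (16 * B1) ^+ d.
    apply: det_le_fact => i j.
    have -> : M i j = t i * (row i Y) ord0 j.
      by rewrite rowY !mxE mulrA mulfV ?mul1r // gt_eqF.
    rewrite normrM gtr0_norm //; apply: ler_pM => //; last exact: B1K.
      exact: ltW.
    have : de <= (t i)^-1 by rewrite -tE /de lerD2l lerN2.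
    move=> /(lt_le_trans de16); rewrite div1r ltf_pV2 ?posrE // => /ltW //.
  apply: (@le_trans _ _ C%:E).
    rewrite lee_fin /C; have : 8 ^+ d * `|\det M| <= CA by rewrite ler_pM2l.
    by move: e80 CB0; clear; lra.
  by rewrite -[leLHS]mule1 lee_pmul2l ?lte_fin // leeDl.
have [j dej jde] := dyadic_scale den de16.
set N : R := 2 ^+ j.+2 in dej jde.
have N0 : 0 < N by rewrite exprn_gt0.
set s : R := N ^- 2 in dej jde.
have s0 : 0 < s by rewrite invr_gt0 exprn_gt0.
have s16 : s <= 1 / 16.
  have N4 : 4 <= N.
    rewrite /N !exprS mulrA (_ : 2 * 2 = 4) ?ler_peMr ?exprn_ege1 ?ler1n //; ring.
  by rewrite /s div1r lef_pV2 ?posrE ?exprn_gt0 //; move: N4; clear; nra.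
have h1 : dotp (row i0 Y) (x - p) < 1 by rewrite -subr_gt0.
have h2 : 3 / 4 <= dotp (row i0 Y) (x - p) by move: de16; rewrite /de; clear; lra.
have h3 : 1 - s <= dotp (row i0 Y) (x - p) by move: dej; rewrite /de; clear; lra.
have [H [mH lH] Hsub] := cap_exchange mO uY YK Ymax h1 h2 h3 jde.
have Sj : ((N ^+ d.+1)%:E * (\1_(shell Omega p (1 - 4 * s)) x)%:E +
       (N ^+ (2 * d.+1))%:E * leb d (xsection (exchange_set Omega p
         (3 * s) ((48 * d%:R) ^+ d * N ^- d.+1)) x) <= 1 + Sum)%E.
  rewrite /Sum (bigD1 j) //= -/N -/s; apply: lee_paddl; first exact: lee01.
  by apply: leeDl; apply: sume_ge0 => k _; exact: term0.
apply: (@le_trans _ _ (C%:E * ((N ^+ d.+1)%:E * (\1_(shell Omega p (1 - 4 * s)) x)%:E +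
       (N ^+ (2 * d.+1))%:E * leb d (xsection (exchange_set Omega p
         (3 * s) ((48 * d%:R) ^+ d * N ^- d.+1)) x)))%E); last first.
  by rewrite lee_pmul2l ?lte_fin.
have [small|big] := lerP `|\det M| (N ^+ d.+1).
  (* The row [i0] of [Y] is at most 1 on [Omega - p] and at least 1 - s > 1 - 4 s at [x - p]. *)
  have -> : \1_(shell Omega p (1 - 4 * s)) x = 1 :> R.
    rewrite indicE mem_set //; apply: (@shellP _ _ _ _ (row i0 Y)) => //.
    - by move: s16; clear; lra.
    - by apply/dual_atP; exact: YK.
    - by move: s0 h3; clear; lra.
  rewrite mule1; apply: (@le_trans _ _ (C%:E * (N ^+ d.+1)%:E)%E); last first.
    by rewrite lee_pmul2l ?lte_fin // leeDl // mule_ge0 // lee_fin exprn_ge0 // ltW.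
  rewrite -EFinM lee_fin; apply: ler_pM => //.
  by rewrite /C; move: CA0 CB0; clear; lra.
set G := exchange_set _ _ _ _.
have mG : measurable G by exact: measurable_exchange_set.
(* By [E1], the caps have measure at most (48 d)^d / |det M|, which the lower bound on the
   determinant makes small enough. *)
have HG : H `<=` xsection G x.
  move=> y /Hsub[Ky xy lecap]; rewrite /xsection /G /exchange_set /= inE; split => //=.
  apply: (le_trans lecap); rewrite E1 lee_fin ler_pM2l ?exprn_gt0 ?mulr_gt0 //.
  by rewrite lef_pV2 ?posrE ?exprn_gt0 // ltW.
have lHG : (leb d H <= leb d (xsection G x))%E.
  by apply: le_measure; rewrite ?inE //; exact: measurable_xsection.
apply: (@le_trans _ _ (C%:E * ((N ^+ (2 * d.+1))%:E * leb d H))%E); last first.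
  rewrite lee_pmul2l ?lte_fin //.
  apply: (@le_trans _ _ ((N ^+ (2 * d.+1))%:E * leb d (xsection G x))%E).
    by rewrite lee_pmul2l ?lte_fin ?exprn_gt0.
  by apply: leeDr; rewrite mule_ge0 // lee_fin exprn_ge0 // ltW.
rewrite lH E2 -/de -!EFinM lee_fin.
(* From s <= 4 de and N^2 s = 1 follows 4 N^2 de >= 1. *)
have hde : 1 <= 4 ^+ d.+1 * (N ^+ (2 * d.+1) * de ^+ d.+1).
  rewrite exprM -!exprMn exprn_ege1 //.
  have : N ^+ 2 * s = 1 by rewrite /s mulfV // gt_eqF // exprn_gt0.
  have : 0 < N ^+ 2 by rewrite exprn_gt0.
  by move: jde; clear; nra.
have P0 : 0 < (4 * d%:R) ^+ d :> R by rewrite exprn_gt0 // mulr_gt0.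
have hCB : CB <= C by rewrite /C; move: CA0 e80; clear; lra.
apply: (@le_trans _ _ (CB * (N ^+ (2 * d.+1) * ((4 * d%:R) ^- d * de ^+ d.+1 * `|\det M|)))).
  rewrite /CB [leRHS](_ : _ = 8 ^+ d * `|\det M| * (4 ^+ d.+1 * (N ^+ (2 * d.+1) * de ^+ d.+1))).
    by rewrite ler_peMr // mulr_ge0 // ltW.
  by field; rewrite gt_eqF.
apply: ler_wpM2r => //; apply: mulr_ge0; first by rewrite exprn_ge0 // ltW.
apply: mulr_ge0 => //; apply: mulr_ge0; first by rewrite invr_ge0 ltW.
by rewrite exprn_ge0 // ltW.
Qed.

End pointwise.

(** * Integrals over shells and exchange sets *)

Lemma le_integral_subset d (T : measurableType d) (R : realType)
    (mu : {measure set T -> \bar R}) (D : set T) (f g : T -> \bar R) :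
  (forall x, D x -> (0 <= f x)%E) -> (forall x, (0 <= g x)%E) ->
  (forall x, D x -> (f x <= g x)%E) ->
  (\int[mu]_(x in D) f x <= \int[mu]_x g x)%E.
Proof.
(* The integral of a nonnegative function is a supremum over the simple functions below it, so the
   comparison applies to arbitrary [f], in particular to the density. *)
move=> f0 g0 fg; rewrite ge0_integralE // ge0_integralTE //.
apply: ereal_sup_le => _ [h hf <-]; exists h => // x.
apply: (le_trans (hf x)); rewrite patchE; case: ifPn => // /set_mem; exact: fg.
Qed.

Lemma bernoulli_onem (R : realType) (t : R) n : 0 <= t <= 1 -> 1 - t ^+ n <= n%:R * (1 - t).
Proof.
move=> /andP[t0 t1]; elim: n => [|n IHn]; first by rewrite expr0 subrr mul0r.
rewrite exprS -natr1; have : t ^+ n <= 1 by rewrite exprn_ile1.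
have : 0 <= t ^+ n by rewrite exprn_ge0.
nra.
Qed.

Section volume_bound.
Context {R : realType} {d : nat}.
Local Notation leb := (@lebesgue_rV R).
Implicit Types (Omega : set 'rV[R]_d) (p q u v w x y z : 'rV[R]_d).

Lemma lebesgue_bounded (A : set 'rV[R]_d) (B : R) : 0 < B -> coord_bounded A B ->
  measurable A -> exists2 m : R, 0 <= m & leb d A = m%:E.
Proof.
move=> B0 AB mA.
have le : (leb d A <= (\prod_(i < d) (B - - B))%:E)%E.
  rewrite -lebesgue_rV_itv => [|_]; last by lra.
  apply: le_measure; rewrite ?inE //; first exact: measurable_itv_rV.
  by move=> w Aw i; rewrite -ler_norml AB.
have fin : leb d A \is a fin_num by rewrite ge0_fin_numE // (le_lt_trans le) ?ltry.
by exists (fine (leb d A)); rewrite ?fineK // fine_ge0.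
Qed.

(** The homothetic image [P] of [A] lies in [A] and has measure t^d m; Bernoulli's inequality bounds
    1 - t^d by d (1 - t). *)
Lemma lebesgue_shell_le (A : set 'rV[R]_d) c (t m : R) : measurable A -> leb d A = m%:E ->
  0 < t <= 1 -> (forall v, A (t^-1 *: (v - c) + c) -> A v) ->
  measurable (shell A c t) /\ (leb d (shell A c t) <= (d%:R * (1 - t) * m)%:E)%E.
Proof.
move=> mA Am /andP[t0 t1] star.
have m0 : 0 <= m by rewrite -lee_fin -Am.
set P := (fun v => t^-1 *: (v - c) + c) @^-1` A.
have PE : P = (fun v => v *m t^-1%:M + (c - t^-1 *: c)) @^-1` A.
  apply/seteqP; split=> v; rewrite /P /= mul_mx_scalar;
    (have -> : t^-1 *: (v - c) + c = t^-1 *: v + (c - t^-1 *: c)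
      by rewrite scalerBr addrAC addrA) => //.
have mP : measurable P by rewrite PE; apply: measurable_preimage => //; exact: measurable_affine.
have lP : leb d P = (t ^+ d * m)%:E.
  have u : t^-1%:M \in @unitmx R d.
    by rewrite unitmxE det_scalar; apply: unitrX; rewrite unitfE invr_neq0 // gt_eqF.
  have := lebesgue_affine (c - t^-1 *: c) u mA; rewrite -PE Am det_scalar => h.
  rewrite EFinM -h muleA -EFinM gtr0_norm ?exprn_gt0 ?invr_gt0 //.
  by rewrite exprVn mulfV ?mul1e // gt_eqF // exprn_gt0.
split; first exact: measurableD.
have AP : A `&` P = P by apply: setIidr => v; exact: star.
have Afin : (leb d A < +oo)%E by rewrite Am ltry.
have E : leb d (A `\` P) = (leb d A - leb d (A `&` P))%E := measureD mA mP Afin.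
rewrite /shell -/P E AP lP Am -EFinB lee_fin.
have := @bernoulli_onem R t d; rewrite (ltW t0) t1 => /(_ isT) h.
by rewrite -{1}(mul1r m) -mulrBl ler_wpM2r.
Qed.

Lemma convex_star (A : set 'rV[R]_d) c (t : R) : is_convex A -> A c -> 0 < t <= 1 ->
  forall v, A (t^-1 *: (v - c) + c) -> A v.
Proof.
move=> cA Ac /andP[t0 t1] v Av.
have E : v = t *: (t^-1 *: (v - c) + c) + (1 - t) *: c.
  by apply/rowP => i; rewrite !mxE; field; exact: lt0r_neq0.
by rewrite E; apply: cA => //; rewrite (ltW t0) t1.
Qed.

Lemma polar_convex (A : set 'rV[R]_d) : is_convex (polar A).
Proof.
move=> x y t Ax Ay /andP[t0 t1] v Av; rewrite dotpDl !dotpZl.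
have := Ax v Av; have := Ay v Av; nra.
Qed.

(** Integrate over [x] first: the section at [y] has measure at most [T], and it is empty unless [y]
    lies in the shell of the dual, because <y, x - p> >= 1 - s > t for the functional [x - p]. *)
Lemma integral_exchange_le Omega p (s T t mK : R) : measurable Omega -> 0 <= T ->
  0 < t -> t <= 1 -> t < 1 - s -> leb d (dual_at Omega p) = mK%:E ->
  (\int[leb d]_x leb d (xsection (exchange_set Omega p s T) x) <=
    (T * (d%:R * (1 - t) * mK))%:E)%E.
Proof.
move=> mO T0 t0 t1 ts lK.
have mG := measurable_exchange_set p s T mO.
have mKs : measurable (dual_at Omega p) by apply: closed_measurable_rV; exact: closed_polar.
have t01 : 0 < t <= 1 by rewrite t0.
have K0 : dual_at Omega p 0 by apply/dual_atP => w _; rewrite dotp0l.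
have [mS lS] := lebesgue_shell_le mKs lK t01
  (convex_star (@polar_convex _) K0 t01).
have -> : (\int[leb d]_x leb d (xsection (exchange_set Omega p s T) x) =
  \int[leb d]_y leb d (ysection (exchange_set Omega p s T) y))%E.
  exact: (product_measure_swap (leb d) (leb d) mG).
apply: (@le_trans _ _ (\int[leb d]_y (T%:E * (\1_(shell (dual_at Omega p) 0 t) y)%:E))%E).
  apply: le_integral_subset => // [y|y _].
    by rewrite mule_ge0 // lee_fin.
  rewrite indicE; case: (boolP (y \in shell _ _ _)) => [_|yS].
    rewrite mule1.
    have [->|] := eqVneq (ysection (exchange_set Omega p s T) y) set0.
      by rewrite measure0 lee_fin.
    move=> /set0P[x]; rewrite {1}/ysection /= inE => -[/= Ox Ky xy lc].
    apply: le_trans lc; apply: le_measure; rewrite ?inE.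
    - exact: measurable_ysection.
    - exact: measurable_cap.
    - by move=> x'; rewrite /ysection /= inE => -[].
  rewrite mule0 (_ : ysection _ _ = set0) ?measure0 // -subset0 => x.
  rewrite /ysection /= inE => -[/= Ox Ky xy _]; case/negP: yS; apply/mem_set.
  apply: (@shellP _ _ _ _ _ _ (x - p)) => //.
    by move=> w /dual_atP /(_ _ Ox); rewrite subr0 dotpC.
  by rewrite subr0 dotpC (lt_le_trans ts).
rewrite ge0_integralZl_EFin //; last first.
  by apply/measurable_EFinP; exact: measurable_indic.
rewrite integral_indic // setIT EFinM; apply: lee_wpmul2l => //.
Qed.

Lemma enorm_le1 v : (enorm v <= 1) = (dotp v v <= 1).
Proof. by rewrite /enorm -[X in _ <= X]sqrtr1 ler_sqrt. Qed.

(** The unit ball contains the cube of half-side 1/d. *)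
Lemma unit_ball_volume_ge : (0 < d)%N ->
  exists2 m : R, 0 < m & (m%:E <= unit_ball_volume R d)%E.
Proof.
move=> d0; have dpos : 0 < d%:R :> R by rewrite ltr0n.
exists (\prod_(i < d) (d%:R^-1 - - d%:R^-1)).
  by apply: prodr_gt0 => i _; rewrite opprK addr_gt0 // invr_gt0.
rewrite -lebesgue_rV_itv => [|_]; last by rewrite -subr_ge0 opprK addr_ge0 // invr_ge0 ltW.
apply: le_measure; rewrite ?inE; first exact: measurable_itv_rV.
  have mf : measurable_fun setT (fun v : 'rV[R]_d => dotp v v).
    by apply: measurable_sum => i; apply: measurable_funM; exact: measurable_coord.
  have := measurable_preimage mf (measurable_itv `]-oo, 1]).
  rewrite (_ : _ @^-1` _ = [set v | enorm v <= 1]) //.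
  by apply/seteqP; split=> v /=; rewrite in_itv /= enorm_le1.
move=> v /= vd; rewrite enorm_le1.
apply: (@le_trans _ _ (\sum_(i < d) d%:R^-1)).
  apply: ler_sum => i _; have /andP[h1 h2] := vd i.
  have hd : d%:R^-1 <= 1 :> R by rewrite invf_le1 // ler1n.
  have : 0 <= d%:R^-1 :> R by rewrite invr_ge0 ltW.
  by move: h1 h2 hd; move: (v ord0 i) (d%:R^-1) => a b; clear; nra.
by rewrite sumr_const card_ord -[_ *+ d]mulr_natr mulVf // gt_eqF.
Qed.

End volume_bound.

(** * Growth of balls and entropy *)

Section volume_growth.
Context {R : realType}.
Local Notation leb := (@lebesgue_rV R).

(** Along the radii [n%:R * ln 2], the bound of [hilbert_ball_dual] becomes the one that
    [density_pointwise] takes as hypothesis. *)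
Lemma expR_Nln2 n : expR (- (2 * (n%:R * ln 2))) = 4 ^- n :> R.
Proof.
rewrite expRN mulrA (mulrC 2) -mulrA (mulrC n%:R) expRM_natr; congr (_ ^- _).
rewrite (_ : 2 * ln 2 = ln 2 + ln 2); last by ring.
by rewrite expRD lnK ?posrE //; ring.
Qed.

Lemma holmes_thompson_ball_le (d : nat) (Omega : set 'rV[R]_d) (p : 'rV[R]_d) :
  (0 < d)%N -> convex_body Omega -> interior Omega p ->
  exists2 C : R, 0 < C & forall n,
    (holmes_thompson_volume Omega (hilbert_ball Omega p (n%:R * ln 2)) <=
      (C * n.+1%:R * (2 ^+ n) ^+ d.-1)%:E)%E.
Proof.
move=> d0 bO ip.
have clO := convex_body_closed bO; have cO := convex_body_convex bO.
have [B B0 OB] := convex_body_bounded bO.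
have [B1 B10 B1K] := dual_bounded ip.
have mO := closed_measurable_rV clO.
have mK : measurable (dual_at Omega p) by apply: closed_measurable_rV; exact: closed_polar.
have [vO vO0 lO] := lebesgue_bounded B0 OB mO.
have [vK vK0 lK] := lebesgue_bounded B10 B1K mK.
have [m m0 mle] := @unit_ball_volume_ge R d d0.
have [C0 C00 hC0] := density_pointwise d0 clO cO B0 OB ip.
pose dR : R := d%:R.
have Ed : d.+1 = (2 + d.-1)%N by case: (d) d0.
pose K := 4 * dR * vO + (48 * dR) ^+ d * (4 * dR * vK).
have dR0 : 0 <= dR by rewrite /dR.
have K0 : 0 <= K.
  by rewrite addr_ge0 // !mulr_ge0 // exprn_ge0 // mulr_ge0.
(* The summand 1 makes [C] positive, as [vO] and [K] are only known to be nonnegative. *)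
pose C := C0 / m * (vO + K * 2 ^+ d.-1) + 1.
have C0m : 0 < C0 / m by rewrite divr_gt0.
have C1 : 0 < C by rewrite /C ltr_wpDl // mulr_ge0 ?(ltW C0m) // addr_ge0 // mulr_ge0.
exists C => // n.
pose N (j : 'I_n) : R := 2 ^+ j.+2.
(* For s = N_j^-2, the ratio 1 - 4 s is less than 1 - 3 s, the level of the exchange set, so the
   same ratio serves for the shell of the dual. *)
pose S (j : 'I_n) := shell Omega p (1 - 4 * N j ^- 2).
pose G (j : 'I_n) := exchange_set Omega p (3 * N j ^- 2) ((48 * d%:R) ^+ d * N j ^- d.+1).
pose g1 (j : 'I_n) x := ((N j ^+ d.+1)%:E * (\1_(S j) x)%:E)%E.
pose g2 (j : 'I_n) x := ((N j ^+ (2 * d.+1))%:E * leb d (xsection (G j) x))%E.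
pose g x := ((C0 / m)%:E * ((\1_Omega x)%:E + \sum_(j < n) (g1 j x + g2 j x)))%E.
have N4 j : 4 <= N j.
  by rewrite /N !exprS mulrA (_ : 2 * 2 = 4) ?ler_peMr ?exprn_ege1 ?ler1n //; ring.
have N0 j : 0 < N j by rewrite exprn_gt0.
have s0 j : 0 < N j ^- 2 by rewrite invr_gt0 exprn_gt0.
have s16 j : N j ^- 2 <= 1 / 16.
  by rewrite div1r lef_pV2 ?posrE ?exprn_gt0 //; have := N4 j; move: (N j) => a; clear; nra.
have t01 j : 0 < 1 - 4 * N j ^- 2 <= 1.
  by move: (s0 j) (s16 j); move: (N j ^- 2) => a; clear; lra.
have shellS j := lebesgue_shell_le mO lO (t01 j) (convex_star cO (interior_subset ip) (t01 j)).
have mG j : measurable (G j) by exact: measurable_exchange_set.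
have g10 j x : (0 <= g1 j x)%E by rewrite /g1 mule_ge0 // lee_fin exprn_ge0 // ltW.
have g20 j x : (0 <= g2 j x)%E by rewrite /g2 mule_ge0 // lee_fin exprn_ge0 // ltW.
have g12 j x : (0 <= g1 j x + g2 j x)%E by rewrite adde_ge0.
have sum0 x : (0 <= \sum_(j < n) (g1 j x + g2 j x))%E by apply: sume_ge0.
have ind0 x : (0 <= (\1_Omega x)%:E :> \bar R)%E by rewrite lee_fin indicE.
have mg1 j : measurable_fun setT (g1 j).
  apply: measurable_funeM; apply/measurable_EFinP; apply: measurable_indic.
  by case: (shellS j).
have mg2 j : measurable_fun setT (g2 j).
  by apply: measurable_funeM; exact: measurable_fun_xsection.
have step1 : (holmes_thompson_volume Omega (hilbert_ball Omega p (n%:R * ln 2)) <=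
    \int[leb d]_x g x)%E.
  apply: le_integral_subset.
  - by move=> x _; rewrite /holmes_thompson_density mule_ge0 // inve_ge0.
  - by move=> x; rewrite /g mule_ge0 ?lee_fin ?(ltW C0m) // adde_ge0.
  move=> x [xb ix]; rewrite /g indicE mem_set ?mulr1n; last exact: interior_subset.
  rewrite EFinM (muleC C0%:E) -muleA muleC; apply: lee_pmul => //.
  - by rewrite inve_ge0.
  - apply: hC0 => // y Ky; rewrite -expR_Nln2.
    have r0 : 0 <= n%:R * ln 2 :> R by rewrite mulr_ge0 // ln_ge0 // ler1n.
    exact: (hilbert_ball_dual clO OB cO ip r0 xb Ky).
  - have := @inver R m; rewrite gt_eqF // => <-.
    rewrite lee_pV2 // ?inE ?measure_ge0 // lee_fin ltW //.
apply: (le_trans step1).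
rewrite ge0_integralZl_EFin //; [|by move=> x _; rewrite adde_ge0| | exact: ltW]; last first.
  apply: emeasurable_funD; first by apply/measurable_EFinP; exact: measurable_indic.
  by apply: emeasurable_sum => j; apply: emeasurable_funD.
rewrite ge0_integralD //; last 2 first.
- by apply/measurable_EFinP; exact: measurable_indic.
- by apply: emeasurable_sum => j; apply: emeasurable_funD.
rewrite integral_indic // setIT ge0_integral_sum //; last first.
  by move=> j; apply: emeasurable_funD.
(* Each scale contributes O(N^(d-1)): the shells have measure O(N^-2), with weight N^(d+1) in the
   first term and N^(2(d+1)) N^-(d+1) in the second. Moreover N is at most 2^(n+1). *)
have bound j : (\int[leb d]_x (g1 j x + g2 j x) <= (K * (2 ^+ n.+1) ^+ d.-1)%:E)%E.
  rewrite ge0_integralD // /g1 /g2 !ge0_integralZl_EFin //; last 4 first.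
  - exact: measurable_fun_xsection.
  - by rewrite exprn_ge0 // ltW.
  - by apply/measurable_EFinP; apply: measurable_indic; case: (shellS j).
  - by rewrite exprn_ge0 // ltW.
  rewrite integral_indic // ?setIT; last by case: (shellS j).
  have b1 : ((N j ^+ d.+1)%:E * leb d (S j) <= (4 * dR * vO * N j ^+ d.-1)%:E)%E.
    apply: (@le_trans _ _ ((N j ^+ d.+1)%:E * (dR * (1 - (1 - 4 * N j ^- 2)) * vO)%:E)%E).
      apply: lee_wpmul2l; first by rewrite lee_fin exprn_ge0 // ltW.
      by case: (shellS j).
    rewrite -EFinM lee_fin Ed exprD le_eqVlt; apply/orP; left; apply/eqP; field.
    by rewrite gt_eqF.
  have b2 : ((N j ^+ (2 * d.+1))%:E * \int[leb d]_x leb d (xsection (G j) x) <=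
      ((48 * dR) ^+ d * (4 * dR * vK) * N j ^+ d.-1)%:E)%E.
    apply: (@le_trans _ _ ((N j ^+ (2 * d.+1))%:E * ((48 * dR) ^+ d * N j ^- d.+1 *
        (dR * (1 - (1 - 4 * N j ^- 2)) * vK))%:E)%E).
      apply: lee_wpmul2l; first by rewrite lee_fin exprn_ge0 // ltW.
      have /andP[t0 t1] := t01 j.
      apply: integral_exchange_le => //.
        by rewrite mulr_ge0 ?exprn_ge0 ?mulr_ge0 // invr_ge0 exprn_ge0 // ltW.
      by move: (s0 j); move: (N j ^- 2) => a; clear; lra.
    rewrite -EFinM lee_fin mulnC exprM Ed exprD le_eqVlt; apply/orP; left; apply/eqP.
    have : N j ^+ d.-1 != 0 by rewrite expf_neq0 // gt_eqF.
    move: (N j ^+ d.-1) => a a0; field; rewrite a0 gt_eqF //.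
  apply: (le_trans (leeD b1 b2)); rewrite -EFinD lee_fin -mulrDl -/K ler_wpM2l //.
  apply: lerXn2r; rewrite ?nnegrE ?exprn_ge0 // ?(ltW (N0 j)) //.
  by rewrite /N ler_eXn2l ?ltr1n // ltnS.
apply: (@le_trans _ _ ((C0 / m)%:E * (vO%:E + \sum_(j < n) (K * (2 ^+ n.+1) ^+ d.-1)%:E))%E).
  apply: lee_wpmul2l; first by rewrite lee_fin ltW.
  have lO' : (leb d Omega <= vO%:E)%E by rewrite lO.
  by apply: leeD; [exact: lO'|apply: lee_sum => j _; exact: bound].
rewrite sumEFin sumr_const card_ord -EFinD -EFinM lee_fin -[_ *+ n]mulr_natr.
rewrite exprS exprMn.
have : 1 <= (2 ^+ n) ^+ d.-1 :> R by rewrite exprn_ege1 // exprn_ege1 // ler1n.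
rewrite -[n.+1%:R]natr1 /C; have : 0 <= n%:R :> R by [].
have : 0 <= K * 2 ^+ d.-1 by rewrite mulr_ge0.
rewrite mulrA; move: vO0 C0m; move: (C0 / m) (K * _) (n%:R) ((2 ^+ n) ^+ d.-1) => a b c e.
clear=> vO0 a0 b0 c0 e1.
have h1 : 0 <= (c + 1) * e - 1 by nra.
have h2 : 0 <= e by lra.
have -> : (a * (vO + b) + 1) * (c + 1) * e = a * (vO + b * e * c) +
  (a * vO * ((c + 1) * e - 1) + a * (b * e) + (c + 1) * e) by ring.
rewrite lerDl; apply: addr_ge0; last nra.
by apply: addr_ge0; apply: mulr_ge0 => //; try exact: ltW; apply: mulr_ge0 => //; exact: ltW.
Qed.

(** Keep the quadratic term of the exponential series at [ln y]. *)
Lemma ln_sq_le (y : R) : 1 <= y -> ln y ^+ 2 <= 2 * y.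
Proof.
move=> y1; have y0 : 0 < y by apply: lt_le_trans y1.
have := @expR_ge1Dxn R (ln y) 1 (ln_ge0 y1); rewrite lnK ?posrE // => h.
have : (ln y ^+ 2) / (2`!)%:R <= y by apply: le_trans h; rewrite lerDr.
by rewrite ler_pdivrMr ?ltr0n // mulrC.
Qed.

(** Beyond any threshold [M] there is a radius at which an arbitrarily small exponential rate
    absorbs the factor [C * n.+1%:R] of the volume bound. *)
Lemma ex_large_nat (C M eta : R) : 0 < C -> 0 < eta ->
  exists n : nat, [/\ (0 < n)%N, M < n%:R * ln 2 &
    ln C + ln n.+1%:R <= eta * (n%:R * ln 2)].
Proof.
move=> C0 eta0; have l2 : 0 < ln 2 :> R by rewrite ln_gt0 // ltr1n.
pose a := eta * ln 2 / 2; have a0 : 0 < a by rewrite divr_gt0 // mulr_gt0.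
(* One summand per requirement: [n%:R * ln 2 > M]; then ln (n+1)^2 <= 2 (n+1) <= 4 n <= (a n)^2;
   then ln C <= a n; and n >= 1. *)
pose X := `|M| / ln 2 + 4 / a ^+ 2 + `|ln C| / a + 1.
have X1 : 0 <= `|M| / ln 2 by rewrite divr_ge0 // ltW.
have X2 : 0 < 4 / a ^+ 2 by rewrite divr_gt0 // exprn_gt0.
have X3 : 0 <= `|ln C| / a by rewrite divr_ge0 // ltW.
have X0 : 0 <= X by rewrite /X; lra.
have [n Xn] : exists n : nat, X < n%:R by exists (Num.bound X); exact: archi_boundP.
have n1 : 1 <= n%:R :> R by move: Xn; rewrite /X; lra.
exists n; split; first by rewrite -(ltr0n R); lra.
  rewrite -ltr_pdivrMr // (le_lt_trans _ Xn) // /X.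
  have : M / ln 2 <= `|M| / ln 2 by rewrite ler_pM2r ?invr_gt0 // ler_norm.
  lra.
have h1 : ln C <= a * n%:R.
  rewrite mulrC -ler_pdivrMr // (le_trans _ (ltW Xn)) // /X.
  have : ln C / a <= `|ln C| / a by rewrite ler_pM2r ?invr_gt0 // ler_norm.
  lra.
have h2 : ln n.+1%:R <= a * n%:R :> R.
  have L0 : 0 <= ln n.+1%:R :> R by rewrite ln_ge0 // ler1n.
  have an0 : 0 <= a * n%:R by rewrite mulr_ge0 // ltW.
  rewrite -(ler_pXn2r (_ : 0 < 2)%N) ?nnegrE //.
  apply: (le_trans (ln_sq_le _)); first by rewrite ler1n.
  have : 4 / a ^+ 2 <= n%:R by move: Xn; rewrite /X; lra.
  rewrite ler_pdivrMr ?exprn_gt0 // -[n.+1%:R]natr1 [(a * _) ^+ 2]exprMn.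
  have : 0 < a ^+ 2 by rewrite exprn_gt0.
  move: (a ^+ 2) (n%:R : R) n1 => b c c1 b0 h.
  have c0 : 0 <= c by lra.
  have := ler_wpM2l c0 h; rewrite (_ : b * c ^+ 2 = c * (c * b)); [lra|ring].
have -> : eta * (n%:R * ln 2) = a * n%:R + a * n%:R by rewrite /a; field.
exact: lerD.
Qed.

End volume_growth.

Theorem corollary3 (R : realType) (d : nat) (hd : (0 < d)%N)
    (Omega : set 'rV[R]_d) (hOmega : convex_body Omega)
    (p : 'rV[R]_d) (hp : interior Omega p) :
  (volume_entropy Omega p <= (d%:R - 1)%:E)%E.
Proof.
have [C C0 hC] := holmes_thompson_ball_le hd hOmega hp.
(* The lower limit is the supremum, over neighbourhoods [V] of infinity, of the infima over [V];
   each infimum is bounded by the value at a single radius [n%:R * ln 2] beyond [M]. *)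
rewrite /volume_entropy limf_einfE; apply: ge_ereal_sup => _ [V [M [_ MV]] <-].
apply/lee_addgt0Pr => eta eta0.
have [n [n0 nM nC]] := ex_large_nat M C0 eta0.
have l2 : 0 < ln 2 :> R by rewrite ln_gt0 // ltr1n.
set r := n%:R * ln 2 in nM nC *.
have r0 : 0 < r by rewrite mulr_gt0 // ltr0n.
apply: (@le_trans _ _ (lne (holmes_thompson_volume Omega (hilbert_ball Omega p r)) * (r^-1)%:E)%E).
  by apply: ereal_inf_lbound; exists r => //; exact: MV.
set v := holmes_thompson_volume _ _.
have v0 : (0 <= v)%E.
  rewrite /v /holmes_thompson_volume; apply: integral_ge0 => x _.
  by rewrite /holmes_thompson_density mule_ge0 // inve_ge0.
have P0 : 0 < (2 ^+ n) ^+ d.-1 :> R by rewrite exprn_gt0 // exprn_gt0.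
have Q0 : 0 < C * n.+1%:R * (2 ^+ n) ^+ d.-1 :> R by rewrite !mulr_gt0.
have le1 : (lne v <= (ln (C * n.+1%:R * (2 ^+ n) ^+ d.-1))%:E)%E.
  rewrite -lne_EFin // lee_lne ?hC // in_itv /= ?v0 ?leey //.
  by rewrite lee_fin ltW.
apply: (@le_trans _ _ ((ln (C * n.+1%:R * (2 ^+ n) ^+ d.-1))%:E * (r^-1)%:E)%E).
  by apply: lee_wpmul2r => //; rewrite lee_fin invr_ge0 ltW.
rewrite -EFinM -EFinD lee_fin ler_pdivrMr //.
have Ed : d%:R - 1 = d.-1%:R :> R by rewrite -{1}(prednK hd) -natr1 addrK.
(* The logarithm splits into ln C + ln (n+1), at most eta r by the choice of [n], and (d - 1) r. *)
rewrite Ed !lnM ?posrE ?mulr_gt0 // -exprM lnXn // mulrDl.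
rewrite (_ : ln 2 *+ (n * d.-1) = d.-1%:R * r); first by move: nC; lra.
by rewrite -[ln 2 *+ _]mulr_natr natrM /r; ring.
Qed.
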